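(* Fix a constant $c>0$ and a sequence of finite $d$-regular graphs $(G_d)_{d\in\mathbb{N}}$; let $p=c/d$ and let $G_{d,p}$ be the random spanning subgraph of $G_d$ obtained by retaining each edge independently with probability $p$. For $r\in\mathbb{N}$, let $\mu_{r,d}$ be the random (empirical) measure on finite rooted graphs given, conditionally on $G_{d,p}$, by $$\mu_{r,d}(H,u)=\frac{1}{|V(G_{d,p})|}\,\big|\{v\in V(G_{d,p}) : B^r_{G_{d,p}}[v]\simeq (H,u)\}\big|,$$ and let $\mu_r$ be the distribution of $B^r_{\mathrm{GW}_c}[o]$, where $\mathrm{GW}_c$ is a Galton–Watson tree with root $o$ and offspring distribution $\mathrm{Po}(c)$. Then for every $r\in\mathbb{N}$, $$\mathbb{P}\Big(d_{\mathrm{TV}}(\mu_{r,d},\mu_r)\ge \exp\big(-\tfrac14(\log d)^{1/(2r)}\big)\Big)=o(d^{-1/3})\quad\text{as } d\to\infty.$$ In particular, $(\mu_{r,d})_{d\in\mathbb{N}}$ converges locally in probability to $\mu_r$; that is, for every $r$ and every finite rooted graph $(\bar H,\bar u)$, $\mu_{r,d}(\bar H,\bar u)\to \mu_r(\bar H,\bar u)$ in probability as $d\to\infty$.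
   Context: For a graph $H$, a vertex $v$ and an integer $r\ge0$, $B^r_H[v]$ denotes the subgraph of $H$ induced by the vertices at graph distance at most $r$ from $v$, viewed as a graph rooted at $v$; $\simeq$ denotes isomorphism of rooted graphs. Logarithms are natural. For probability measures $\mu_1,\mu_2$ on a countable set $\Omega$ (here the isomorphism classes of finite rooted graphs), $d_{\mathrm{TV}}(\mu_1,\mu_2)=\frac12\sum_{\omega\in\Omega}|\mu_1(\omega)-\mu_2(\omega)|$. *)

(* Defs.v *)
From HB Require Import structures.
From mathcomp Require Import all_boot all_order all_algebra.
From mathcomp Require Import all_classical all_reals all_analysis.
From mathcomp Require Import poisson_distribution.
Set Implicit Arguments. Unset Strict Implicit. Unset Printing Implicit Defensive.
Import Order.TTheory GRing.Theory Num.Theory.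

Local Open Scope ring_scope.

Record rgraph := RGraph { rg_T : finType ; rg_adj : rel rg_T ; rg_root : rg_T }.

Definition rg_iso (G H : rgraph) : Prop :=
  exists f : rg_T G -> rg_T H,
    [/\ bijective f, f (@rg_root G) = @rg_root H &
        forall x y, @rg_adj H (f x) (f y) = @rg_adj G x y].

(* Codes of finite rooted graphs: vertex set 'I_n.+1, root ord0.       *)
Definition rcode := {n : nat & {ffun 'I_n.+1 * 'I_n.+1 -> bool}}.

Definition rg_of_code (x : rcode) : rgraph :=
  @RGraph 'I_(tag x).+1 (fun i j => tagged x (i, j)) ord0.

Definition simple_code (x : rcode) : Prop :=
  (forall i j, tagged x (i, j) = tagged x (j, i)) /\ (forall i, ~~ tagged x (i, i)).

Definition rclass (A : set rcode) : Prop :=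
  exists x : rcode, simple_code x /\ A = [set y | rg_iso (rg_of_code y) (rg_of_code x)]%classic.

Definition in_class (G : rgraph) (A : set rcode) : Prop :=
  exists2 x, A x & rg_iso G (rg_of_code x).

Fixpoint within (V : finType) (a : rel V) (r : nat) (v w : V) : bool :=
  if r is k.+1 then within a k v w || [exists u, within a k v u && a u w]
  else v == w.

Lemma within_refl (V : finType) (a : rel V) r v : within a r v v.
Proof. by elim: r => [|r IH] /=; [rewrite eqxx | rewrite IH]. Qed.

Definition ball (V : finType) (a : rel V) (r : nat) (v : V) : rgraph :=
  @RGraph {w : V | within a r v w} (fun x y => a (sval x) (sval y))
          (exist _ v (within_refl a r v)).

Definition edges (V : finType) (e : rel V) : {set {set V}} :=
  [set [set u; v] | u in V, v in V & e u v].

Definition sub_adj (V : finType) (F : {set {set V}}) : rel V :=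
  fun u v => (u != v) && ([set u; v] \in F).

(* probability that G_p has exactly edge set F (F a subset of E(G)) *)
Definition perc_weight (R : realType) (V : finType) (e : rel V) (p : R)
    (F : {set {set V}}) : R :=
  p ^+ #|F| * (1 - p) ^+ (#|edges e| - #|F|).

Definition perc_prob (R : realType) (V : finType) (e : rel V) (p : R)
    (Q : {set {set V}} -> bool) : R :=
  \sum_(F in powerset (edges e) | Q F) perc_weight e p F.

Definition regular (V : finType) (e : rel V) (d : nat) : Prop :=
  forall v, #|[set w | e v w]| = d.

Definition mu_emp (R : realType) (V : finType) (a : rel V) (r : nat)
    (A : set rcode) : R :=
  #|[set v : V | `[< in_class (ball a r v) A >]]|%:R / #|V|%:R.

(* Galton-Watson tree with Po(c) offspring, first r generations, as a   *)
(* random plane (Ulam-Harris) tree.                                     *)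
Arguments mu_emp {R V} a r A.

Inductive ptree := PNode of seq ptree.
HB.instance Definition _ := gen_eqMixin ptree.
HB.instance Definition _ := gen_choiceMixin ptree.

Fixpoint gw_law (R : realType) (c : R) (r : nat) (t : ptree) : R :=
  match r, t with
  | 0, PNode ts => if ts is [::] then 1 else 0
  | k.+1, PNode ts => poisson_pmf c (size ts) * \prod_(s <- ts) gw_law c k s
  end.

(* Ulam-Harris words of the vertices of a plane tree *)
Fixpoint positions (t : ptree) : seq (seq nat) :=
  let: PNode ts := t in
  [::] :: (fix aux (i : nat) (ss : seq ptree) : seq (seq nat) :=
             match ss with
             | [::] => [::]
             | s :: ss' => [seq i :: w | w <- positions s] ++ aux i.+1 ss'
             end) 0 ts.

Lemma positions_root t : [::] \in positions t.
Proof. by case: t => ts; rewrite /= mem_head. Qed.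

Definition tadj (u v : seq nat) : bool :=
  ((size v == (size u).+1) && (take (size u) v == u)) ||
  ((size u == (size v).+1) && (take (size v) u == v)).

Definition rg_of_ptree (t : ptree) : rgraph :=
  @RGraph (seq_sub (positions t)) (fun x y => tadj (ssval x) (ssval y))
          (SeqSub (positions_root t)).

Definition mu_gw (R : realType) (c : R) (r : nat) (A : set rcode) : \bar R :=
  \esum_(t in [set t : ptree | in_class (rg_of_ptree t) A]%classic) (gw_law c r t)%:E.

Definition dTV (R : realType) (mu1 : set rcode -> R) (mu2 : set rcode -> \bar R) : \bar R :=
  (2^-1)%:E * \esum_(A in rclass) `|((mu1 A)%:E - mu2 A)%E|.

(* Main.v *)
Require Import Defs.
From HB Require Import structures.
From mathcomp Require Import all_boot all_order all_algebra.
From mathcomp Require Import all_classical all_reals all_analysis.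
From mathcomp Require Import perm poisson_distribution.
From mathcomp Require finmap.
From mathcomp Require Import zify ring lra.
Set Implicit Arguments. Unset Strict Implicit. Unset Printing Implicit Defensive.
Import Order.TTheory GRing.Theory Num.Theory.
Import numFieldNormedType.Exports.
Local Open Scope ring_scope.

(** Explore the percolated graph from a vertex [v] without backtracking, down to depth [r]. If no
    label repeats, and no open edge joins two vertices of the last generation, then the [r]-ball of
    [v] is the explored plane tree. Since both laws have total mass one, the total variation
    distance is [1 - sum min], so only lower bounds on the empirical frequency of each plane tree
    [t] are needed, and only for the finitely many [t] whose offspring numbers are at most [K].

    The expected frequency of [t] is at least [gw t - O(K^O(r) / d)]: count copies of [t] in the
    [d]-regular graph, each of which is explored with probability at least [p^(#edges)]
    [(1 - p)^(d * #inner vertices)]. Flipping one edge [xy] changes the exploration of at most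
    [2 (K+1)^r] vertices, those reaching [x] or [y] through explored vertices of degree at most
    [K+1]; hence by Efron-Stein the frequency has variance [O(K^O(r) / d)]. Open edges inside the
    last generation cost [O(K^O(r) / d)] in expectation, as the exploration ignores them.

    There are at most [(K+1)^((K+1)^r)] such trees, and the others have mass [O(exp(-K))]. With
    [K] about [(log d)^(1/(2r))] the former is [d^o(1)], the latter is far below the threshold
    [exp(-K/4)], and Markov's inequality gives a probability [d^(-1/2 + o(1))]. *)

(** * Expectation over independent edges *)

Section BernoulliExpectation.
Context {R : realType} {T : finType}.
Implicit Types (Om D F : {set T}) (f g : {set T} -> R) (p : R) (a : T).

(** Expectation as a finite sum with the weights of [perc_weight]; no probability space is built. *)
Definition Ex p Om f : R :=
  \sum_(F in powerset Om) p ^+ #|F| * (1 - p) ^+ (#|Om| - #|F|) * f F.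

Lemma eq_Ex p Om f g : (forall F, F \subset Om -> f F = g F) -> Ex p Om f = Ex p Om g.
Proof.
by move=> fg; apply: eq_bigr => F; rewrite inE => /fg ->.
Qed.

Lemma Ex_set0 p f : Ex p finset.set0 f = f finset.set0.
Proof. by rewrite /Ex powerset0 big_set1 cards0 subnn !expr0 !mul1r. Qed.

(** Conditioning on whether [a] is retained. This recursion on the ground set drives the inductions
    below. *)
Lemma Ex_setU1 p Om a f : a \notin Om ->
  Ex p (a |: Om) f = Ex p Om (fun F => p * f (a |: F) + (1 - p) * f F).
Proof.
move=> aOm; rewrite /Ex (bigID (fun F => a \in F)) /=.
have sub F : a \notin F -> (F \subset a |: Om) = (F \subset Om).
  move=> aF; apply/idP/idP => [/fintype.subsetP FO|FO].
    apply/fintype.subsetP => x xF; have := FO _ xF; rewrite in_setU1 => /orP[/eqP xa|//].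
    by rewrite -xa xF in aF.
  exact: fintype.subset_trans FO (finset.subsetUr _ _).
have -> : \sum_(F in powerset (a |: Om) | a \notin F)
    p ^+ #|F| * (1 - p) ^+ (#|a |: Om| - #|F|) * f F =
    \sum_(F in powerset Om) p ^+ #|F| * (1 - p) ^+ (#|Om| - #|F|) * ((1 - p) * f F).
  apply: eq_big => [F|F].
    rewrite !inE; apply/andP/idP => [[FO aF]|FO]; first by rewrite -sub.
    have aF : a \notin F by apply: contra aOm; apply: (fintype.subsetP FO).
    by rewrite sub.
  rewrite inE => /andP[FO aF]; rewrite sub // in FO.
  by rewrite cardsU1 aOm add1n subSn ?subset_leq_card // exprSr; ring.
rewrite (reindex_onto (fun F => a |: F) (fun F => F :\ a)) /=; last first.
  by move=> F /andP[_ aF]; rewrite finset.setD1K.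
have -> : \sum_(F | (a |: F \in powerset (a |: Om)) && (a \in a |: F) && ((a |: F) :\ a == F))
    p ^+ #|a |: F| * (1 - p) ^+ (#|a |: Om| - #|a |: F|) * f (a |: F) =
    \sum_(F in powerset Om) p ^+ #|F| * (1 - p) ^+ (#|Om| - #|F|) * (p * f (a |: F)).
  apply: eq_big => [F|F].
    rewrite !inE eqxx andbT /=; apply/andP/idP => [[FO /eqP aF]|FO].
      rewrite -aF -sub ?setD11 //; exact: fintype.subset_trans (subD1set _ _) FO.
    have aF : a \notin F by apply: contra aOm; apply: (fintype.subsetP FO).
    by rewrite finset.setUS // setU1K.
  rewrite inE => /andP[_ /eqP aF].
  have {}aF : a \notin F by rewrite -aF setD11.
  by rewrite !cardsU1 aOm aF !add1n subSS exprSr; ring.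
by rewrite -big_split /=; apply: eq_bigr => F _; rewrite -mulrDr.
Qed.

Lemma finset_ind (P : {set T} -> Prop) :
  P finset.set0 -> (forall a Om, a \notin Om -> P Om -> P (a |: Om)) -> forall Om, P Om.
Proof.
move=> P0 PS Om; have [n] := ubnP #|Om|; elim: n => // n IH in Om *.
have [->//|[a aOm]] := finset.set_0Vmem Om.
rewrite (cardsD1 a) aOm add1n ltnS => Omn.
by rewrite -(finset.setD1K aOm); apply: PS; [rewrite setD11|apply: IH].
Qed.

Lemma ExD p Om f g : Ex p Om (fun F => f F + g F) = Ex p Om f + Ex p Om g.
Proof. by rewrite /Ex -big_split /=; apply: eq_bigr => F _; rewrite mulrDr. Qed.

Lemma ExZ p Om k f : Ex p Om (fun F => k * f F) = k * Ex p Om f.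
Proof. by rewrite /Ex mulr_sumr; apply: eq_bigr => F _; rewrite mulrCA. Qed.

Lemma ExZr p Om k f : Ex p Om (fun F => f F * k) = Ex p Om f * k.
Proof. by rewrite mulrC -ExZ; apply: eq_Ex => F _; rewrite mulrC. Qed.

Lemma Ex_sum p Om (I : Type) (s : seq I) (P : pred I) (f : I -> {set T} -> R) :
  Ex p Om (fun F => \sum_(i <- s | P i) f i F) = \sum_(i <- s | P i) Ex p Om (f i).
Proof.
rewrite /Ex exchange_big /=; apply: eq_bigr => F _.
by rewrite mulr_sumr.
Qed.

Lemma Ex_cst p Om k : Ex p Om (fun=> k) = k.
Proof.
elim/finset_ind: Om => [|a Om aOm IH]; first by rewrite Ex_set0.
rewrite Ex_setU1 // -[RHS]IH; apply: eq_Ex => F _; ring.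
Qed.

Section Probability.
Variables (p : R) (p0 : 0 <= p) (p1 : p <= 1).

Lemma le_Ex Om f g : (forall F, F \subset Om -> f F <= g F) -> Ex p Om f <= Ex p Om g.
Proof.
move=> fg; apply: ler_sum => F; rewrite inE => FO.
by apply: ler_wpM2l; rewrite ?fg// mulr_ge0// exprn_ge0// subr_ge0.
Qed.

Lemma Ex_ge0 Om f : (forall F, F \subset Om -> 0 <= f F) -> 0 <= Ex p Om f.
Proof. by move=> f0; rewrite -(Ex_cst p Om 0); apply: le_Ex. Qed.

(* Tensorization of the variance (Efron-Stein), in the bounded differences case. *)
Lemma Ex_var Om f (L : R) : 0 <= L ->
  (forall a F, a \in Om -> a \notin F -> `|f (a |: F) - f F| <= L) ->
  Ex p Om (fun F => f F ^+ 2) <= Ex p Om f ^+ 2 + #|Om|%:R * (p * L ^+ 2).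
Proof.
move=> L0; elim/finset_ind: Om f => [|a Om aOm IH] f H.
  by rewrite !Ex_set0 cards0 mul0r addr0.
rewrite !Ex_setU1 // cardsU1 aOm natrD mulrDl mul1r.
pose g F := p * f (a |: F) + (1 - p) * f F.
have q0 : 0 <= 1 - p by rewrite subr_ge0.
have := IH g; rewrite -/g => /(_ _)/le_trans IHg.
have st : Ex p Om (fun F => p * f (a |: F) ^+ 2 + (1 - p) * f F ^+ 2) <=
   Ex p Om (fun F => g F ^+ 2) + p * L ^+ 2.
  rewrite -[p * L ^+ 2](Ex_cst p Om) -ExD; apply: le_Ex => F FO.
  have aF : a \notin F by apply: contra aOm; apply: (fintype.subsetP FO).
  have {}H : (f (a |: F) - f F) ^+ 2 <= L ^+ 2.
    rewrite -real_normK ?num_real//; apply: lerXn2r; rewrite ?nnegrE//.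
    by apply: H => //; rewrite setU11.
  (* Second moment of a two-point variable: squared mean plus [p (1 - p)] times the squared gap. *)
  have -> : p * f (a |: F) ^+ 2 + (1 - p) * f F ^+ 2 =
     g F ^+ 2 + p * (1 - p) * (f (a |: F) - f F) ^+ 2 by rewrite /g; ring.
  rewrite lerD2l -mulrA; apply: ler_wpM2l => //; apply: le_trans H.
  by rewrite ler_piMl ?sqr_ge0// lerBlDr lerDl.
rewrite (le_trans st) // addrCA [X in X <= _]addrC lerD2l IHg //.
(* Averaging over [a] preserves bounded differences: an increment of [g] is a convex combination of
   two increments of [f]. *)
move=> b F bOm bF; rewrite /g.
have bDa : b != a by apply: contraNneq aOm => <-.
have -> : p * f (a |: (b |: F)) + (1 - p) * f (b |: F) - (p * f (a |: F) + (1 - p) * f F)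
  = p * (f (b |: (a |: F)) - f (a |: F)) + (1 - p) * (f (b |: F) - f F).
  by rewrite finset.setUCA; ring.
apply: le_trans (ler_normD _ _) _; rewrite !normrM (ger0_norm p0) (ger0_norm q0).
have -> : L = p * L + (1 - p) * L by ring.
by apply: lerD; apply: ler_wpM2l => //; apply: H; rewrite ?in_setU1 ?bOm ?orbT// negb_or bDa.
Qed.

(** The variance of [|f|] is nonnegative. *)
Lemma Ex_norm_sqr Om f : Ex p Om (fun F => `|f F|) ^+ 2 <= Ex p Om (fun F => f F ^+ 2).
Proof.
pose m := Ex p Om (fun F => `|f F|).
have : 0 <= Ex p Om (fun F => (`|f F| - m) ^+ 2) by apply: Ex_ge0 => F _; rewrite sqr_ge0.
rewrite (@eq_Ex _ _ _ (fun F => f F ^+ 2 + ((- 2 * m) * `|f F| + m ^+ 2))); last first.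
  by move=> F _; rewrite sqrrB real_normK ?num_real//; ring.
by rewrite ExD ExD ExZ Ex_cst -/m => h; lra.
Qed.

(** The mean absolute deviation is at most the standard deviation, which [Ex_var] bounds. *)
Lemma Ex_dev Om f (L : R) : 0 <= L ->
  (forall a F, a \in Om -> a \notin F -> `|f (a |: F) - f F| <= L) ->
  Ex p Om (fun F => `|f F - Ex p Om f|) <= Num.sqrt (#|Om|%:R * p) * L.
Proof.
move=> L0 H; have nn : 0 <= Num.sqrt (#|Om|%:R * p) * L by rewrite mulr_ge0 ?sqrtr_ge0.
rewrite -(@ler_sqr R) ?nnegrE//; last by apply: Ex_ge0.
apply: le_trans (Ex_norm_sqr _ _) _.
rewrite exprMn sqr_sqrtr ?mulr_ge0// -mulrA.
have := Ex_var L0 H; set m := Ex p Om f => V.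
rewrite (@eq_Ex _ _ _ (fun F => f F ^+ 2 + ((- 2 * m) * f F + m ^+ 2))); last first.
  by move=> F _; ring.
by rewrite ExD ExD ExZ Ex_cst -/m; lra.
Qed.

(** A function that ignores [a] is independent of the state of [a]. *)
Lemma Ex_toggle Om g a (b : bool) : a \in Om ->
  (forall F, a \notin F -> g (a |: F) = g F) ->
  Ex p Om (fun F => g F * ((a \in F) == b)%:R) = (if b then p else 1 - p) * Ex p Om g.
Proof.
move=> aOm ga; rewrite -(finset.setD1K aOm); set O := Om :\ a.
have aO : a \notin O by rewrite setD11.
rewrite !Ex_setU1 // -ExZ; apply: eq_Ex => F FO.
have aF : a \notin F by apply: contra aO; apply: (fintype.subsetP FO).
by rewrite setU11 (negbTE aF) ga //; case: b; rewrite !eqxx /=; ring.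
Qed.

(** The exact value is [p^|D :&: E| (1 - p)^|D :\: E|]. The surplus factors on the left are at most
    1, and they leave a bound in terms of sizes only. *)
Lemma Ex_cylinder Om D (E : seq T) : D \subset Om ->
  p ^+ size E * (1 - p) ^+ #|D| <=
  Ex p Om (fun F => [forall b in D, (b \in F) == (b \in E)]%:R).
Proof.
elim/finset_ind: D E => [|a D aD IH] E DO.
  rewrite cards0 expr0 mulr1 (@eq_Ex _ _ _ (fun=> 1)) ?Ex_cst ?exprn_ile1//.
  by move=> F _; rewrite (_ : [forall _ in _, _])//; apply/forall_inP => x; rewrite inE.
have q0 : 0 <= 1 - p by rewrite subr_ge0.
have aOm : a \in Om by rewrite (fintype.subsetP DO) ?setU11.
have {}DO : D \subset Om by apply: fintype.subset_trans DO; exact: finset.subsetUr.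
have EE (E' : seq T) : (forall x, x \in D -> (x \in E') = (x \in E)) ->
  Ex p Om (fun F => [forall b in a |: D, (b \in F) == (b \in E)]%:R) =
  (if a \in E then p else 1 - p) * Ex p Om (fun F => [forall b in D, (b \in F) == (b \in E')]%:R).
  move=> EE'; rewrite -(@Ex_toggle Om _ a (a \in E)) //; last first.
    move=> F aF; congr (_%:R); congr nat_of_bool; apply: eq_forallb => x; rewrite in_setU1.
    by have [->|] := eqVneq x a; rewrite ?(negbTE aD).
  apply: eq_Ex => F _; rewrite -natrM mulnb; congr (_%:R); congr nat_of_bool.
  apply/forall_inP/andP => [H|[/forall_inP H /eqP aF] x].
    split; last by rewrite (eqP (H a _)) ?setU11.
    by apply/forall_inP => x xD; rewrite EE'// H// in_setU1 xD orbT.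
  case/setU1P => [->|xD]; first by rewrite aF.
  by rewrite -EE'// H.
rewrite cardsU1 aD add1n exprS.
have [aE|aE] := boolP (a \in E).
  (* All copies of [a] leave the sequence, so at least one factor [p] is released. *)
  set E' := [seq x <- E | x != a].
  have sE : (size E' < size E)%N.
    by rewrite size_filter -(count_predC (pred1 a)) -[ltnLHS]add0n ltn_add2r -has_count has_pred1.
  rewrite (EE E') ?aE; last first.
    by move=> x xD; rewrite mem_filter (_ : x != a)//; apply: contraNneq aD => <-.
  apply: le_trans (ler_wpM2l p0 (IH E' DO)); rewrite mulrA [leRHS]mulrA.
  apply: ler_wpM2r; first by rewrite exprn_ge0.
  apply: (@le_trans _ _ (p ^+ size E)); first by rewrite ler_piMr ?exprn_ge0// lerBlDr lerDl.
  by rewrite -exprS ler_wiXn2l.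
rewrite (EE E) // (negbTE aE) mulrCA; apply: ler_wpM2l => //; exact: IH.
Qed.

Lemma Ex_markov Om f (Q : {set T} -> bool) (x : R) : 0 < x ->
  (forall F, F \subset Om -> 0 <= f F) ->
  (forall F, F \subset Om -> Q F -> x <= f F) ->
  Ex p Om (fun F => (Q F)%:R) <= Ex p Om f / x.
Proof.
move=> x0 f0 H; rewrite ler_pdivlMr // -ExZr; apply: le_Ex => F FO.
by case: (boolP (Q F)) => QF; rewrite ?mul1r ?mul0r ?H ?f0.
Qed.

End Probability.
End BernoulliExpectation.

(** * Labelled plane trees and exploration *)

Lemma rg_iso_sym G H : rg_iso G H -> rg_iso H G.
Proof.
case=> f [[g fK gK] f0 fadj]; exists g; split; first by exists f.
  by rewrite -f0 fK.
by move=> x y; rewrite -fadj !gK.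
Qed.

Lemma rg_iso_trans G H K : rg_iso G H -> rg_iso H K -> rg_iso G K.
Proof.
case=> f [bf f0 fadj] [g [bg g0 gadj]]; exists (g \o f); split.
- exact: bij_comp.
- by rewrite /= f0.
- by move=> x y; rewrite /= gadj.
Qed.

(** The anonymous fixpoint inside [positions], named so that inductions can refer to it. *)
Fixpoint pos_forest (i : nat) (ss : seq ptree) : seq (seq nat) :=
  if ss is s :: ss' then [seq i :: w | w <- positions s] ++ pos_forest i.+1 ss' else [::].

Lemma positionsE ts : positions (PNode ts) = [::] :: pos_forest 0 ts.
Proof. by []. Qed.

Lemma mem_pos_forest i ss u : (u \in pos_forest i ss) =
  if u is j :: w then (i <= j)%N && (if onth ss (j - i) is Some s then w \in positions s else false)
  else false.
Proof.
elim: ss i u => [|s ss IH] i u /=.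
  by case: u => [|j w]; rewrite ?in_nil// onth0n andbF.
rewrite mem_cat IH; case: u => [|j w].
  by rewrite orbF; apply/mapP => -[].
have [ij|ij|->] := ltngtP i j.
- rewrite (_ : (j - i = (j - i.+1).+1)%N) /=; last by lia.
  rewrite (_ : (j :: w \in _) = false) //; apply/mapP => -[x _ [ji]]; lia.
- rewrite /= orbF; apply/mapP => -[x _ [ji]]; lia.
- rewrite subnn /= orbF; apply/mapP/idP => [[x xs [->]]//|ws]; by exists w.
Qed.

Lemma size_positions ts :
  size (positions (PNode ts)) = (sumn [seq size (positions s) | s <- ts]).+1.
Proof.
rewrite positionsE /=; congr _.+1.
by elim: ts 0%N => //= s ss IH i; rewrite size_cat size_map IH.
Qed.

(** Plane trees whose nodes carry vertices of a graph. Labels may repeat, as an exploration may meet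
    a vertex twice along a cycle. *)
Inductive ltree (V : Type) := LNode of V & seq (ltree V).
HB.instance Definition _ (V : Type) := gen_eqMixin (ltree V).

Section LabelledTrees.
Variable V : finType.
Implicit Types (v w x y par : V) (s t : ltree V) (ts : seq (ltree V)) (a : rel V) (u : seq nat).

Definition lroot t := let: LNode v _ := t in v.
Definition lkids t := let: LNode _ ts := t in ts.
Fixpoint labels t : seq V := let: LNode v ts := t in v :: flatten [seq labels s | s <- ts].
Fixpoint lshape t : ptree := let: LNode v ts := t in PNode [seq lshape s | s <- ts].

(** The labels at depth below [r]: the vertices whose adjacency the exploration reads. *)
Fixpoint inner r t : seq V :=
  if r is k.+1 then let: LNode v ts := t in v :: flatten [seq inner k s | s <- ts] else [::].

(* Non-backtracking exploration to depth [r] from [v], entered from [par]; at the start one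
   takes [par = v], which excludes nothing when [a] is irreflexive. *)
Fixpoint expl a r par v : ltree V :=
  LNode v (if r is k.+1 then [seq expl a k v w | w <- enum [pred w | a v w && (w != par)]]
           else [::]).

Fixpoint subtree t u : option (ltree V) :=
  if u is i :: u' then if onth (lkids t) i is Some s then subtree s u' else None else Some t.

Definition olab t u : option V := omap lroot (subtree t u).

Lemma ltree_mem_ind (P : ltree V -> Prop) :
  (forall v ts, (forall s, s \in ts -> P s) -> P (LNode v ts)) -> forall t, P t.
Proof.
move=> H; fix IH 1; case=> v ts; apply: H; elim: ts => [|s ts IHts] s'.
  by rewrite in_nil => F; discriminate F.
by case/predU1P => [->|/IHts h]; [exact: IH|exact: h].
Qed.

Lemma lroot_expl a r par v : lroot (expl a r par v) = v.
Proof. by case: r. Qed.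

Lemma subtree_rcons t u i : subtree t (rcons u i) = obind (fun s => onth (lkids s) i) (subtree t u).
Proof.
elim: u t => [|j u IH] t /=; first by case: onth.
by case: onth => //= s; rewrite IH.
Qed.

Lemma mem_positions_shape t u : (u \in positions (lshape t)) = isSome (subtree t u).
Proof.
elim: u t => [|i u IH] [v ts]; first by rewrite positions_root.
rewrite [lshape _]/= positionsE in_cons /= mem_pos_forest subn0 leq0n /= onth_map.
by case: onth => //= s; rewrite IH.
Qed.

Lemma map_olab_positions t : [seq olab t u | u <- positions (lshape t)] = map Some (labels t).
Proof.
elim/ltree_mem_ind: t => v ts IH; rewrite [lshape _]/= positionsE /=; congr (_ :: _).
(* Generalized to a suffix [ss] of the children, whose words start at the index [size pre]. *)
have : forall pre ss, {subset ss <= ts} ->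
    [seq olab (LNode v (pre ++ ss)) u | u <- pos_forest (size pre) [seq lshape s | s <- ss]]
    = map Some (flatten [seq labels s | s <- ss]).
  move=> pre ss; elim: ss pre => //= s ss IHs pre sst.
  rewrite !map_cat; congr (_ ++ _).
    rewrite -map_comp -IH ?sst ?mem_head//; apply: eq_map => u /=.
    by rewrite /olab /= onth_cat ltnn subnn.
  by rewrite -cat_rcons -(size_rcons pre s) IHs// => z zs; rewrite sst// in_cons zs orbT.
by move=> /(_ [::] ts); apply.
Qed.

Lemma size_labels t : size (labels t) = size (positions (lshape t)).
Proof. by rewrite -(size_map Some) -map_olab_positions size_map. Qed.

Lemma subtree_labels t u s : subtree t u = Some s -> lroot s \in labels t.
Proof.
move=> us; rewrite -(mem_map (@Some_inj _)) -map_olab_positions.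
by apply/mapP; exists u; rewrite ?mem_positions_shape /olab us.
Qed.

Lemma uniq_positions_shape t : uniq (labels t) -> uniq (positions (lshape t)).
Proof. by rewrite -(map_inj_uniq (@Some_inj _)) -map_olab_positions; exact: map_uniq. Qed.

(** Positions and labels are listed in the same order, so a label that occurs once determines its
    position. *)
Lemma subtree_inj t u u' s s' : uniq (labels t) ->
  subtree t u = Some s -> subtree t u' = Some s' -> lroot s = lroot s' -> u = u'.
Proof.
rewrite -(map_inj_uniq (@Some_inj _)) -map_olab_positions => U us us' ss'.
have P : u \in positions (lshape t) by rewrite mem_positions_shape us.
have P' : u' \in positions (lshape t) by rewrite mem_positions_shape us'.
have : olab t u = olab t u' by rewrite /olab us us' /= ss'.
rewrite -{1}(nth_index [::] P) -{1}(nth_index [::] P') -!(nth_map [::] None) ?index_mem//.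
move/eqP; rewrite nth_uniq ?size_map ?index_mem// => /eqP e.
by rewrite -(nth_index [::] P) e nth_index.
Qed.

Lemma subtree_inner r t x : x \in inner r t -> exists u s, [/\ (size u < r)%N, subtree t u = Some s & lroot s = x].
Proof.
elim: r t => // r IH [v ts]; rewrite /= in_cons => /orP[/eqP->|].
  by exists [::], (LNode v ts).
case/flatten_mapP => s sts /IH[u [s' [ur us' <-]]].
have [i si] := onthP sts.
by exists (i :: u), s'; split; rewrite //= si.
Qed.

(** Self-similarity of the exploration: below [u] it continues with the remaining depth, entered
    from the label of the parent word. Induction on the last letter of [u] keeps that parent at
    hand. *)
Lemma expl_subtree a r par v u s : subtree (expl a r par v) u = Some s ->
  exists k q, [/\ s = expl a k q (lroot s), r = (size u + k)%N &
    (u = [::] /\ q = par) \/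
    (exists u' i s', [/\ u = rcons u' i, subtree (expl a r par v) u' = Some s' & q = lroot s'])].
Proof.
elim/last_ind: u s => [|u i IH] s.
  by move=> [<-]; exists r, par; split; rewrite ?lroot_expl//; left.
rewrite subtree_rcons; case us : subtree => [s'|]//= si.
have [k [q [s'E rE _]]] := IH _ us.
case: k => [|k] in s'E rE *; first by move: si; rewrite s'E /= onth0n.
move: si; rewrite s'E /= onth_map; case: onth => //= w [sE].
exists k, (lroot s'); split; first by rewrite -sE lroot_expl.
  by rewrite rE size_rcons addnS.
by right; exists u, i, s'.
Qed.

(** Locality: adjacency is queried only at inner vertices. The effect of toggling an edge is
    controlled through this. *)
Lemma expl_det a a' r par v :
  (forall x y, x \in inner r (expl a r par v) -> a x y = a' x y) ->
  expl a' r par v = expl a r par v.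
Proof.
elim: r par v => // r IH par v /= H; congr LNode.
have -> : enum [pred w | a' v w && (w != par)] = enum [pred w | a v w && (w != par)].
  by apply: eq_enum => w; rewrite !inE H ?mem_head.
apply/eq_in_map => w wE; apply: IH => x y xi; apply: H.
rewrite in_cons; apply/orP; right; apply/flatten_mapP.
by exists (expl a r v w) => //; apply/mapP; exists w.
Qed.

(** * When the explored tree is the ball *)

Section BallIso.
Variables (a : rel V) (r : nat) (v : V).
Hypotheses (sym_a : symmetric a) (irr_a : irreflexive a).
Let t := expl a r v v.
Hypothesis uniq_t : uniq (labels t).
Hypothesis closed_t : forall x y, x \in labels t -> y \in labels t -> a x y ->
  (x \in inner r t) || (y \in inner r t).

Let kid_adj u i s s' : subtree t u = Some s -> subtree t (rcons u i) = Some s' -> a (lroot s) (lroot s').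
Proof.
move=> us; rewrite subtree_rcons us /=; have [[|k] [q [sE _ _]]] := expl_subtree us.
  by rewrite sE /= onth0n.
rewrite {1}sE /= onth_map; case E: onth => [w|]//= [<-].
have : w \in enum [pred w | a (lroot s) w && (w != q)] by apply/onthP; exists i.
by rewrite mem_enum lroot_expl inE => /andP[].
Qed.

(** Above the last generation every neighbour has been explored: it is the parent label [q] or one
    of the children. *)
Let adj_word u s y : subtree t u = Some s -> (size u < r)%N -> a (lroot s) y ->
  exists u' s', [/\ subtree t u' = Some s', lroot s' = y, tadj u u' & (size u' <= (size u).+1)%N].
Proof.
move=> us ur sy; have [k [q [sE rE qE]]] := expl_subtree us.
case: k => [|k] in sE rE; first by rewrite rE addn0 ltnn in ur.
have [yq|yq] := eqVneq y q.
  (* At the root [q] is [v] itself, so [y = q] would be a loop. *)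
  case: qE => [[u0 qv]|[u' [i [s' [uE us' qE]]]]].
    by move: us sy; rewrite u0 /= => -[<-]; rewrite lroot_expl yq qv irr_a.
  exists u', s'; rewrite us' yq qE uE size_rcons; split=> //; last by lia.
  by rewrite /tadj size_rcons eqxx -cats1 take_size_cat// eqxx orbT.
have yk : y \in enum [pred w | a (lroot s) w && (w != q)] by rewrite mem_enum inE sy.
have [i yi] := onthP yk.
have si : onth (lkids s) i = Some (expl a k (lroot s) y) by rewrite {1}sE /= onth_map yi.
exists (rcons u i), (expl a k (lroot s) y).
rewrite subtree_rcons us /= si lroot_expl size_rcons; split=> //.
by rewrite /tadj size_rcons eqxx -cats1 take_size_cat// eqxx.
Qed.

(** By [closed_t] an edge has an inner endpoint. Then [adj_word] finds its other end at an adjacent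
    word, which is the given one because labels are distinct. *)
Let adjE u u' s s' : subtree t u = Some s -> subtree t u' = Some s' -> a (lroot s) (lroot s') = tadj u u'.
Proof.
move=> us us'; apply/idP/idP => [ss'|].
  have := closed_t (subtree_labels us) (subtree_labels us') ss'.
  have aux z sz : subtree t z = Some sz -> lroot sz \in inner r t -> (size z < r)%N.
    by move=> zs /subtree_inner[z' [sz' [z'r z's e]]]; rewrite (subtree_inj uniq_t zs z's (esym e)).
  case/orP => [/(aux _ _ us)|/(aux _ _ us')] ur.
    have [u1 [s1 [u1s e ta _]]] := adj_word us ur ss'.
    by rewrite (subtree_inj uniq_t us' u1s (esym e)).
  rewrite sym_a in ss'; have [u1 [s1 [u1s e ta _]]] := adj_word us' ur ss'.
  by rewrite (subtree_inj uniq_t us u1s (esym e)) /tadj orbC.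
have kid z z' sz sz' : subtree t z = Some sz -> subtree t z' = Some sz' ->
    (size z' == (size z).+1) && (take (size z) z' == z) -> a (lroot sz) (lroot sz').
  move=> zs z's /andP[/eqP e /eqP tz].
  case/lastP: z' => [|z' i] in e tz z's *; first by [].
  move: e tz; rewrite size_rcons => -[e]; rewrite -cats1 take_cat e ltnn subnn take0 cats0 => zz.
  by rewrite zz in z's; apply: kid_adj z's.
by case/orP; [exact: kid us us'|rewrite sym_a; exact: kid us' us].
Qed.

Let withinP k w : (k <= r)%N ->
  reflect (exists u s, [/\ (size u <= k)%N, subtree t u = Some s & lroot s = w]) (Defs.within a k v w).
Proof.
elim: k w => [|k IH] w kr /=.
  apply: (iffP eqP) => [<-|[u [s [u0]]]].
    by exists [::], t; rewrite /t lroot_expl.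
  by case: u u0 => //= _ [<-] <-; rewrite lroot_expl.
apply: (iffP orP) => [[/(IH _ (ltnW kr))[u [s [uk us sw]]]|]|[u [s [uk us sw]]]].
- by exists u, s; split=> //; apply: leqW.
- case/existsP => x /andP[/(IH _ (ltnW kr))[u [s [uk us sx]]]]; rewrite -sx => sw.
  have [u' [s' [us' e _ u'k]]] := adj_word us (leq_ltn_trans uk kr) sw.
  by exists u', s'; split=> //; apply: leq_trans u'k _.
move: uk; rewrite leq_eqVlt => /orP[/eqP uk|uk]; last first.
  by left; apply/IH; [exact: ltnW|exists u, s].
right; apply/existsP; case/lastP: u => [|u i] in uk us *; first by [].
case E : (subtree t u) => [s'|]; last by rewrite subtree_rcons E in us.
exists (lroot s'); rewrite -sw (kid_adj E us) andbT.
by apply/IH; [exact: ltnW|exists u, s'; split=> //; move: uk; rewrite size_rcons => -[->]].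
Qed.

Lemma ball_iso : rg_iso (rg_of_ptree (lshape t)) (Defs.ball a r v).
Proof.
pose lab (z : seq_sub (positions (lshape t))) := odflt v (olab t (ssval z)).
have labE z : exists2 s, subtree t (ssval z) = Some s & lab z = lroot s.
  have := ssvalP z; rewrite mem_positions_shape /lab /olab.
  by case: subtree => //= s _; exists s.
have labr z : Defs.within a r v (lab z).
  have [s us ->] := labE z; have [k [q [_ rE _]]] := expl_subtree us.
  by apply/withinP => //; exists (ssval z), s; split=> //; rewrite rE leq_addr.
pose f z : {w : V | Defs.within a r v w} := exist _ (lab z) (labr z).
have f_inj : injective f.
  move=> x y [] /=; have [s us ->] := labE x; have [s' us' ->] := labE y => e.
  by apply: val_inj; exact: subtree_inj uniq_t us us' e.
exists f; split.
(* Every vertex of the ball is a label, so the ball has at most as many vertices as the tree has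
   positions. *)
- apply: inj_card_bij => //=.
  rewrite card_seq_sub ?uniq_positions_shape// -size_labels card_sig.
  apply: leq_trans (subset_leq_card _) (card_size _).
  apply/fintype.subsetP => w; rewrite inE => /withinP[]// u [s [_ us <-]]; exact: subtree_labels us.
- apply: val_inj => /=; have [s /= [<-] ->] := labE (SeqSub (positions_root (lshape t))).
  by rewrite lroot_expl.
- move=> x y /=; have [s us ->] := labE x; have [s' us' ->] := labE y; exact: adjE.
Qed.

End BallIso.
End LabelledTrees.

(** * Exploring the percolated graph *)

Lemma size_flatten_le (S T : Type) (f : S -> seq T) (s : seq S) (m : nat) :
  (forall x, (size (f x) <= m)%N) -> (size (flatten [seq f x | x <- s]) <= size s * m)%N.
Proof.
move=> fm; elim: s => //= x s IH; rewrite size_cat mulSn; exact: leq_add.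
Qed.

Fixpoint bnd (K r : nat) (t : ptree) : bool :=
  let: PNode ts := t in
  if r is k.+1 then (size ts <= K)%N && all (bnd K k) ts else nilp ts.

Lemma size_positions_bnd K r t : bnd K r t -> (size (positions t) <= K.+1 ^ r)%N.
Proof.
elim: r t => [|r IH] [ts]; first by case: ts.
rewrite size_positions => /andP[tK /allP ts_bnd].
have : (sumn [seq size (positions s) | s <- ts] <= size ts * K.+1 ^ r)%N.
  elim: ts ts_bnd {tK} => //= s ts IHts H; rewrite mulSn; apply: leq_add; first by apply/IH/H; rewrite mem_head.
  by apply: IHts => z zs; apply: H; rewrite in_cons zs orbT.
have : (0 < K.+1 ^ r)%N by rewrite expn_gt0.
rewrite expnS; move: (K.+1 ^ r)%N => m; nia.
Qed.

(** * Vertices whose exploration can see a given vertex *)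

Section Reach.
Variables (V : finType) (a : rel V) (K : nat).
Hypothesis sym_a : symmetric a.

(** Explorations traced backwards: the ends of walks of length [j] from [z] whose vertices, the last
    one excepted, have degree at most [K+1], that is [K] children and a parent. *)
Fixpoint reach j (z : V) : seq V :=
  if j is i.+1 then
    flatten [seq if (#|a w| <= K.+1)%N then enum (a w) else [::] | w <- reach i z]
  else [:: z].

Lemma size_reach j z : (size (reach j z) <= K.+1 ^ j)%N.
Proof.
elim: j => //= j IH; rewrite expnSr.
apply: (@leq_trans (size (reach j z) * K.+1)); last by rewrite leq_mul2r IH orbT.
by apply: size_flatten_le => w; case: ifP => // wK; rewrite -cardE.
Qed.

(** The path from [v] down to [z], read backwards. Each vertex on it has at most [K] children
    besides the vertex it was entered from. *)
Lemma inner_reach k par v z : bnd K k (lshape (expl a k par v)) ->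
  z \in inner k (expl a k par v) -> (#|a v| <= K.+1)%N /\ exists2 j, (j < k)%N & v \in reach j z.
Proof.
elim: k par v => // k IH par v /=; rewrite !size_map => /andP[vK bK] zin.
have dv : (#|a v| <= K.+1)%N.
  rewrite (cardD1 par (a v)); apply: (leq_add (leq_b1 _)); apply: leq_trans vK.
  by rewrite -cardE; apply/subset_leq_card/fintype.subsetP => w; rewrite !inE andbC.
split=> //; move: zin; rewrite in_cons => /predU1P[->|]; first by exists 0%N; rewrite //= mem_head.
case/flatten_mapP => s /mapP[w wE ->] zin.
have bw : bnd K k (lshape (expl a k v w)).
  by apply: (allP bK); rewrite -map_comp; apply/mapP; exists w.
have [dw [j jk wj]] := IH _ _ bw zin; exists j.+1 => //=.
apply/flatten_mapP; exists w => //; rewrite dw mem_enum.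
by move: wE; rewrite mem_enum inE sym_a => /andP[].
Qed.

(** The sum of [(K+1)^j] over [j < r] is at most [(K+1)^r], since [K+1 >= 2]. *)
Lemma card_inner_reach r z (A : {set V}) :
  (forall v, v \in A -> bnd K r (lshape (expl a r v v)) /\ z \in inner r (expl a r v v)) ->
  (0 < K)%N -> (#|A| <= K.+1 ^ r)%N.
Proof.
move=> H K0; pose s := flatten [seq reach j z | j <- iota 0 r].
apply: (@leq_trans (size s)).
  apply: leq_trans (subset_leq_card _) (card_size _).
  apply/fintype.subsetP => v /H[bv zv]; have [_ [j jr vj]] := inner_reach bv zv.
  by apply/flatten_mapP; exists j; rewrite // mem_iota.
rewrite {}/s {H}; elim: r => [//|r IH].
rewrite -addn1 iotaD map_cat flatten_cat size_cat /= cats0 add0n addn1 expnS.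
apply: (@leq_trans (K.+1 ^ r + K.+1 ^ r)); first by rewrite leq_add ?size_reach.
by rewrite addnn -mul2n leq_mul2r ltnS K0 orbT.
Qed.

End Reach.

Section Percolation.
Variables (V : finType).
Implicit Types (v w x y : V) (F : {set {set V}}) (t : ptree) (tau s : ltree V).

Lemma sub_adj_sym F : symmetric (sub_adj F).
Proof. by move=> x y; rewrite /sub_adj eq_sym finset.setUC. Qed.

Lemma sub_adj_irr F : irreflexive (sub_adj F).
Proof. by move=> x; rewrite /sub_adj eqxx. Qed.

Lemma sub_adj_toggle F (E : {set V}) x y : x \notin E -> sub_adj (E |: F) x y = sub_adj F x y.
Proof.
move=> xE; rewrite /sub_adj in_setU1; congr (_ && _).
by rewrite (_ : (_ == E) = false)//; apply/negbTE; apply: contraNneq xE => <-; rewrite set21.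
Qed.

Definition Xp r F v := expl (sub_adj F) r v v.
Definition touch r tau (E : {set V}) := has (mem E) (inner r tau).
Definition good r t F v := (lshape (Xp r F v) == t) && uniq (labels (Xp r F v)).

Lemma Xp_toggle r F (E : {set V}) v :
  ~~ touch r (Xp r F v) E || ~~ touch r (Xp r (E |: F) v) E -> Xp r (E |: F) v = Xp r F v.
Proof.
case/orP => /hasPn H; last symmetry; apply: expl_det => x y /H /= xE; rewrite sub_adj_toggle//.
Qed.

Lemma good_bnd r K t F v : bnd K r t -> good r t F v -> bnd K r (lshape (Xp r F v)).
Proof. by move=> tK /andP[/eqP->]. Qed.

Definition cgood r t F := #|[set v | good r t F v]|.

(** One use of [card_inner_reach] for each end of the edge, whence the factor 2. *)
Lemma card_good_touch r K t F E : (0 < K)%N -> bnd K r t -> (exists x y, E = [set x; y]) ->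
  (#|[set v | good r t F v & touch r (Xp r F v) E]| <= 2 * K.+1 ^ r)%N.
Proof.
move=> K0 tK [x [y ->]].
pose A z := [set v | good r t F v & z \in inner r (Xp r F v)].
have AK z : (#|A z| <= K.+1 ^ r)%N.
  apply: (@card_inner_reach _ (sub_adj F) K (@sub_adj_sym F) r z) => // v.
  by rewrite inE => /andP[gv zv]; split=> //; exact: good_bnd gv.
apply: (@leq_trans #|A x :|: A y|).
  apply/subset_leq_card/fintype.subsetP => v; rewrite !inE => /andP[->] /hasP[z zi].
  by rewrite /= !inE => /orP[] /eqP zE; rewrite -zE zi ?orbT.
by rewrite mul2n -addnn; apply: leq_trans (leq_card_setU _ _) _; rewrite leq_add.
Qed.

(** A vertex that loses its goodness under the toggle has an exploration touching [E] in the
    configuration where it is good. This is the bounded difference for Efron-Stein. *)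
Lemma cgood_toggle r K t F E : (0 < K)%N -> bnd K r t -> (exists x y, E = [set x; y]) ->
  (cgood r t (E |: F) <= cgood r t F + 2 * K.+1 ^ r)%N /\
  (cgood r t F <= cgood r t (E |: F) + 2 * K.+1 ^ r)%N.
Proof.
move=> K0 tK Exy; split.
  apply: leq_trans (leq_add (leqnn _) (card_good_touch (E |: F) K0 tK Exy)).
  apply: leq_trans (leq_card_setU _ _); apply/subset_leq_card/fintype.subsetP => v.
  rewrite !inE => gv; rewrite gv /=; case: (boolP (touch _ _ _)); rewrite ?orbT// => nt.
  by rewrite orbF /good -(@Xp_toggle r F E v) ?nt ?orbT.
apply: leq_trans (leq_add (leqnn _) (card_good_touch F K0 tK Exy)).
apply: leq_trans (leq_card_setU _ _); apply/subset_leq_card/fintype.subsetP => v.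
rewrite !inE => gv; rewrite gv /=; case: (boolP (touch _ _ _)); rewrite ?orbT// => nt.
by rewrite orbF /good (@Xp_toggle r F E v) ?nt.
Qed.

(* For an edge [E]: it joins two vertices of the last generation, so that the exploration does not
   see it although it belongs to the induced ball. *)
Definition extra r F v (E : {set V}) :=
  all (mem (labels (Xp r F v))) (enum E) && ~~ touch r (Xp r F v) E.

Lemma good_ball_iso r t F v : good r t F v -> (forall E, E \in F -> ~~ extra r F v E) ->
  rg_iso (rg_of_ptree t) (Defs.ball (sub_adj F) r v).
Proof.
move=> /andP[/eqP<- U] H.
apply: ball_iso U _ => //; [exact: sub_adj_sym|exact: sub_adj_irr|].
move=> x y xl yl /andP[_ /H]; apply: contraR; rewrite negb_or => /andP[xi yi].
apply/andP; split; first by apply/allP => z; rewrite mem_enum !inE => /orP[]/eqP->.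
apply/hasPn => z zi /=; rewrite !inE; apply/negP => /orP[] /eqP zE.
  by rewrite -zE zi in xi.
by rewrite -zE zi in yi.
Qed.

Section Host.
Variable (e : rel V).

Lemma edgesP E : reflect (exists x y, e x y /\ E = [set x; y]) (E \in edges e).
Proof.
apply: (iffP finset.imset2P) => [[x y _]|[x [y [exy ->]]]].
  by rewrite inE => /andP[_ exy] ->; exists x, y.
by exists x y; rewrite ?inE.
Qed.

Lemma card_extra r F v : (#|[set E in edges e | extra r F v E]| <= size (labels (Xp r F v)) ^ 2)%N.
Proof.
set l := labels _.
rewrite expnS expn1 -(size_allpairs (fun x y : V => [set x; y]) l l).
apply: leq_trans (subset_leq_card _) (card_size _); apply/fintype.subsetP => E.
rewrite inE => /andP[/edgesP[x [y [_ ->]]]] /andP[/allP H _].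
by apply/allpairsP; exists (x, y); split=> //=; apply: H; rewrite mem_enum !inE eqxx ?orbT.
Qed.

(** An extra edge is one that the exploration does not touch, so the exploration is the same with
    and without [E]. Hence this event is independent of whether [E] is open. *)
Lemma extra_toggle r t F v E :
  good r t (E |: F) v && extra r (E |: F) v E = good r t F v && extra r F v E.
Proof.
rewrite /good /extra; case: (boolP (touch r (Xp r F v) E)) => [|h]; last by rewrite Xp_toggle ?h.
case: (boolP (touch r (Xp r (E |: F) v) E)) => [|h]; first by rewrite !andbF.
by rewrite -(@Xp_toggle r F E v) ?h ?orbT// (negbTE h).
Qed.

End Host.
End Percolation.

(** * Copies of a plane tree in a regular graph *)

Lemma uniq_flatten_map_inj (S T : eqType) (f : S -> seq T) (ts : seq S) s s' x :
  uniq (flatten [seq f s | s <- ts]) -> s \in ts -> s' \in ts ->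
  x \in f s -> x \in f s' -> s = s'.
Proof.
elim: ts => //= z ts IH; rewrite cat_uniq => /and3P[_ /hasPn zts uts].
have aux y : y \in ts -> x \in f y -> x \in f z -> False.
  move=> yts xy xz; have /zts : x \in flatten [seq f s | s <- ts] by apply/flatten_mapP; exists y.
  by rewrite /= xz.
rewrite !in_cons => /predU1P[->|sts] /predU1P[->|s'ts] // xs xs'.
- by case: (aux _ s'ts xs' xs).
- by case: (aux _ sts xs xs').
- exact: IH.
Qed.

Lemma uniq_flatten_map (S T : eqType) (f : S -> seq T) (ts : seq S) s :
  uniq (flatten [seq f s | s <- ts]) -> s \in ts -> uniq (f s).
Proof.
elim: ts => //= z ts IH; rewrite cat_uniq => /and3P[uz _ uts] /predU1P[->//|]; exact: IH.
Qed.

Lemma size_allpairs_ge (S : eqType) (T R : Type) (f : S -> T -> R) (g : S -> seq T) (xs : seq S) m :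
  {in xs, forall x, (m <= size (g x))%N} ->
  (size xs * m <= size [seq f x y | x <- xs, y <- g x])%N.
Proof.
elim: xs => //= x xs IH H; rewrite size_cat size_map mulSn leq_add ?H ?mem_head//.
by apply: IH => y yxs; apply: H; rewrite in_cons yxs orbT.
Qed.

Section Embeddings.
Variables (V : finType) (e : rel V).
Implicit Types (v w x y : V) (B W : {set V}) (F : {set {set V}}) (t : ptree) (tau s : ltree V).

Fixpoint tedges tau : seq {set V} :=
  let: LNode v ts := tau in flatten [seq [set v; lroot s] :: tedges s | s <- ts].

(** A tree in the host graph in the normal form produced by [expl], the children in the order of
    [enum]. *)
Fixpoint gtree k tau : bool :=
  let: LNode v ts := tau in
  if k is k'.+1 then
    [&& map (@lroot V) ts == enum [set w in map (@lroot V) ts],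
        all (e v) (map (@lroot V) ts) & all (gtree k') ts]
  else nilp ts.

Lemma lroot_labels tau : lroot tau \in labels tau.
Proof. by case: tau => v ts; rewrite mem_head. Qed.

Lemma labelsE tau : labels tau = lroot tau :: behead (labels tau).
Proof. by case: tau. Qed.

Lemma inner_labels k tau : {subset inner k tau <= labels tau}.
Proof.
elim: k tau => // k IH [v ts] x; rewrite /= !in_cons => /orP[->//|/flatten_mapP[s sts xs]].
by apply/orP; right; apply/flatten_mapP; exists s => //; apply: IH.
Qed.

Lemma mem_tedges tau (E : {set V}) x : E \in tedges tau -> x \in E -> x \in labels tau.
Proof.
elim/ltree_mem_ind: tau => v ts IH /= /flatten_mapP[s sts]; rewrite in_cons => /predU1P[->|Es].
  rewrite !inE => /orP[/eqP->|/eqP->]; rewrite ?eqxx//; apply/orP; right.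
  by apply/flatten_mapP; exists s => //; rewrite lroot_labels.
move=> xE; rewrite in_cons; apply/orP; right; apply/flatten_mapP; exists s => //; exact: IH.
Qed.

Lemma gtree_tedges k tau E : gtree k tau -> E \in tedges tau -> E \in edges e.
Proof.
elim: k tau => [|k IH] [v ts]; first by case: ts.
move=> /= /and3P[_ /allP ev /allP gts] /flatten_mapP[s sts]; rewrite in_cons => /predU1P[->|].
  by apply/edgesP; exists v, (lroot s); split=> //; apply: ev; apply/map_f.
by apply: IH; exact: gts.
Qed.

(** If the open pairs at inner vertices are exactly the tree edges, the exploration returns the
    tree. The pair of the root and [par] is exempted: in a subtree it is the edge to the parent,
    open but skipped by the exploration. *)
Lemma expl_gtree k tau par F : gtree k tau -> uniq (labels tau) ->
  par \notin behead (labels tau) ->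
  (forall x y, x \in inner k tau -> x != y -> ~~ ((x == lroot tau) && (y == par)) ->
     ([set x; y] \in F) = ([set x; y] \in tedges tau)) ->
  expl (sub_adj F) k par (lroot tau) = tau.
Proof.
elim: k tau par => [|k IH] [v ts] par; first by case: ts.
move=> /and3P[/eqP rootsE _ /allP gts] /= /andP[vts uts] parts H.
have sv s x : s \in ts -> x \in labels s -> x != v.
  by move=> sts xs; apply: contraNneq vts => <-; apply/flatten_mapP; exists s.
have -> : enum [pred w | sub_adj F v w && (w != par)] = map (@lroot V) ts.
  rewrite rootsE; apply: eq_enum => w; rewrite !inE /sub_adj.
  apply/idP/mapP => [/andP[/andP[vw vwF] wpar]|[s sts ->]].
    move: vwF; rewrite H ?mem_head//=; last by rewrite eqxx.
    case/flatten_mapP => s sts; rewrite in_cons => /predU1P[vs|].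
      have : w \in [set v; lroot s] by rewrite -vs set22.
      by rewrite !inE eq_sym (negbTE vw) => /eqP->; exists s.
    move=> /mem_tedges/(_ (set21 _ _)) => /(sv _ _ sts); by rewrite eqxx.
  have vs : v != lroot s by rewrite eq_sym; apply: sv sts _; exact: lroot_labels.
  have spar : lroot s != par.
    apply: contraNneq parts => <-; apply/flatten_mapP; exists s => //; exact: lroot_labels.
  rewrite vs spar andbT H ?mem_head//= ?(negbTE spar) ?andbF//.
  by apply/flatten_mapP; exists s => //; rewrite mem_head.
congr LNode; rewrite -map_comp -[RHS]map_id; apply/eq_in_map => s sts /=.
have us := uniq_flatten_map uts sts.
apply: IH => //; first exact: gts.
  apply/negP => /mem_behead /(sv _ _ sts); by rewrite eqxx.
move=> x y xi xy nxy; have xs := inner_labels xi; have xv := sv _ _ sts xs.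
rewrite H //; first last.
- by rewrite (negbTE xv).
- by rewrite in_cons; apply/orP; right; apply/flatten_mapP; exists s.
(* A tree edge at a label [x] of [s] lies inside [s], or joins [v] to the root of [s], which is the
   exempted pair. *)
apply/flatten_mapP/idP => [[s' s'ts]|xyE]; last by exists s; rewrite // in_cons xyE orbT.
rewrite in_cons => /predU1P[E|E]; last first.
  by rewrite (uniq_flatten_map_inj uts sts s'ts xs (mem_tedges E (set21 _ _))).
have : x \in [set v; lroot s'] by rewrite -E set21.
rewrite !inE (negbTE xv) => /eqP xs'.
have ss' : s = s' by apply: uniq_flatten_map_inj uts sts s'ts xs _; rewrite xs' lroot_labels.
have : y \in [set v; lroot s'] by rewrite -E set22.
rewrite !inE -xs' [y == x]eq_sym (negbTE xy) orbF => yv.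
by rewrite xs' ss' eqxx yv in nxy.
Qed.

(** The edges whose states decide whether the exploration equals [tau]. *)
Definition dom r tau : {set {set V}} := [set E in edges e | touch r tau E].

Lemma Xp_gtree r tau F v : gtree r tau -> uniq (labels tau) -> lroot tau = v ->
  F \subset edges e -> [forall E in dom r tau, (E \in F) == (E \in tedges tau)] ->
  Xp r F v = tau.
Proof.
move=> g u <- FO /forall_inP H; apply: expl_gtree => //.
  by move: u; rewrite labelsE => /andP[].
move=> x y xi xy _; have [xyO|xyO] := boolP ([set x; y] \in edges e).
  by apply/eqP/H; rewrite inE xyO; apply/hasP; exists x; rewrite //= set21.
transitivity false; last by symmetry; apply: contraNF xyO; exact: (gtree_tedges g).
by apply: contraNF xyO; exact: (fintype.subsetP FO).
Qed.

Section Regular.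
Variables (d : nat).
Hypotheses (sym_e : symmetric e) (reg_e : forall v, #|[set w | e v w]| = d).

Lemma card_dom r tau : (#|dom r tau| <= d * size (inner r tau))%N.
Proof.
pose q := flatten [seq [seq [set x; y] | y <- enum [set w | e x w]] | x <- inner r tau].
apply: (@leq_trans (size q)); last first.
  by rewrite mulnC; apply: size_flatten_le => x; rewrite size_map -cardE reg_e.
apply: leq_trans (subset_leq_card _) (card_size _); apply/fintype.subsetP => E.
rewrite inE => /andP[/edgesP[x [y [exy ->]]] /hasP[z zi]] /=.
rewrite !inE => /orP[]/eqP zE; apply/flatten_mapP; exists z => //; apply/mapP.
  by exists y; rewrite ?mem_enum ?inE zE.
by exists x; rewrite ?mem_enum ?inE zE 1?sym_e// finset.setUC.
Qed.

(** The trees [ts] are placed one after another at the roots [ws]; [B] holds the vertices already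
    used and grows by the labels of each placed tree. *)
Fixpoint forest (emb : ptree -> V -> {set V} -> seq (ltree V)) (ts : seq ptree) (ws : seq V) B :
    seq (seq (ltree V)) :=
  match ts, ws with
  | [::], [::] => [:: [::]]
  | t :: ts', w :: ws' =>
      [seq tau :: ss | tau <- emb t w B, ss <- forest emb ts' ws' (B :|: [set x in labels tau])]
  | _, _ => [::]
  end.

(* Children are listed in the order of [enum], as in [expl], so that distinct copies of [t] are
   explored from distinct configurations. *)
Fixpoint embs k t v B : seq (ltree V) :=
  let: PNode ts := t in
  if k is k'.+1 then
    [seq LNode v ss | W <- enum [set W : {set V} | (W \subset [set w | e v w] :\: B) && (#|W| == size ts)],
                      ss <- forest (embs k') ts (enum W) (B :|: W)]
  else if ts is [::] then [:: LNode v [::]] else [::].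

Lemma embs_root k t v B tau : tau \in embs k t v B -> lroot tau = v.
Proof.
case: k t => [|k] [ts] /=; first by case: ts => //=; rewrite inE => /eqP->.
by case/allpairsPdep => W [ss [_ _ ->]].
Qed.

Lemma forest_root k ts ws B ss : ss \in forest (embs k) ts ws B -> map (@lroot V) ss = ws.
Proof.
elim: ts ws B ss => [|t ts IH] [|w ws] B ss //=; first by rewrite inE => /eqP->.
by case/allpairsPdep => tau [ss' [/embs_root <- /IH <- ->]].
Qed.

Lemma uniq_embs k t v B : uniq (embs k t v B).
Proof.
elim: k t v B => [|k IH] [ts] v B; first by case: ts.
have ufor ts' ws B' : uniq (forest (embs k) ts' ws B').
  elim: ts' ws B' => [|t ts' IHts] [|w ws] B' //=.
  apply: allpairs_uniq_dep => // -[x sx] [y sy] _ _ /= [xy sxy].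
  by rewrite xy sxy.
apply: allpairs_uniq_dep => //; first exact: enum_uniq.
move=> [x sx] [y sy] /allpairsPdep[W [sW [_ sWf E]]] /allpairsPdep[W' [sW' [_ sW'f E']]].
case: E sWf => -> ->; case: E' sW'f => -> -> /= h' h [ss].
(* [W] is recovered as the set of roots of the children. *)
have WW' : W = W'.
  apply/setP => w; rewrite -[LHS]mem_enum -[RHS]mem_enum.
  by rewrite -(forest_root h) -(forest_root h') ss.
by rewrite WW' ss.
Qed.

Lemma perm_labels_forest (ss : seq (ltree V)) :
  perm_eq (flatten [seq labels s | s <- ss])
          (map (@lroot V) ss ++ flatten [seq behead (labels s) | s <- ss]).
Proof.
elim: ss => //= s ss IH; rewrite [labels s]labelsE /= perm_cons.
by rewrite perm_sym perm_catCA perm_cat2l perm_sym.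
Qed.

(** Labels stay distinct because all children [W] are reserved before any of their subtrees is
    placed, and each placed subtree is reserved before the next. *)
Lemma embsP k t v B tau : v \in B -> tau \in embs k t v B ->
  [/\ lshape tau = t, gtree k tau, uniq (labels tau) &
      forall x, x \in behead (labels tau) -> x \notin B].
Proof.
elim: k t v B tau => [|k IH] [ts] v B tau vB.
  by case: ts => //=; rewrite inE => /eqP->.
have forP ts' ws B' ss : {subset ws <= B'} -> ss \in forest (embs k) ts' ws B' ->
    [/\ map (@lshape V) ss = ts', all (gtree k) ss, uniq (flatten [seq behead (labels s) | s <- ss]) &
      forall x, x \in flatten [seq behead (labels s) | s <- ss] -> x \notin B'].
  elim: ts' ws B' ss => [|t ts' IHts] [|w ws] B' ss //=; first by move=> _; rewrite inE => /eqP->.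
  move=> wsB /allpairsPdep[s [ss' [se sse ->]]].
  have wB : w \in B' by rewrite wsB ?mem_head.
  have [<- gs us sB] := IH _ _ _ _ wB se.
  have [|<- gss uss ssB] := IHts _ _ _ _ sse.
    by move=> x xws; rewrite inE wsB// in_cons xws orbT.
  split; rewrite //= ?gs// ?cat_uniq ?uss ?andbT.
    apply/andP; split; first by move: us; rewrite labelsE => /andP[].
    apply/hasPn => x /ssB; rewrite !inE negb_or => /andP[_]; apply: contra; exact: mem_behead.
  move=> x; rewrite mem_cat => /orP[/sB//|/ssB]; by rewrite !inE negb_or => /andP[].
case/allpairsPdep => W [ss [WE sse ->]].
move: WE; rewrite mem_enum inE => /andP[/fintype.subsetP WN /eqP Ws].
have [|shE gss uss ssB] := forP _ _ _ _ _ sse.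
  by move=> x; rewrite mem_enum inE => ->; rewrite orbT.
have rE := forest_root sse.
have lE := perm_labels_forest ss.
have ssBW x : x \in flatten [seq labels s | s <- ss] -> x \notin B.
  rewrite (perm_mem lE) rE mem_cat mem_enum => /orP[/WN|/ssB]; rewrite !inE; first by case/andP.
  by rewrite negb_or => /andP[].
split=> //=.
- by rewrite shE.
- rewrite gss rE andbT; apply/andP; split.
    by apply/eqP/eq_enum => x; rewrite !inE mem_enum.
  by apply/allP => x; rewrite mem_enum => /WN; rewrite !inE => /andP[].
- apply/andP; split; first by apply: contraL vB => /ssBW.
  rewrite (perm_uniq lE) rE cat_uniq enum_uniq uss andbT /=.
  by apply/hasPn => x /ssB; rewrite !inE mem_enum negb_or => /andP[].
Qed.

(** The number of ways to choose all sets of children when every node has exactly [N] free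
    neighbours. *)
Fixpoint cnt N k t : nat :=
  let: PNode ts := t in
  if k is k'.+1 then ('C(N, size ts) * \prod_(s <- ts) cnt N k' s)%N else 1%N.

(** At each node the used vertices number at most [d - N], so [N] neighbours remain free. The bound
    is [d+1] because [v] is counted both in [B] and among the positions. *)
Lemma size_embs N K k t v B : bnd K k t -> v \in B ->
  (N + #|B| + size (positions t) <= d.+1)%N -> (cnt N k t <= size (embs k t v B))%N.
Proof.
elim: k t v B => [|k IH] [ts] v B; first by case: ts.
(* The roots [ws] are counted in [B'] and again as positions, whence [size ts'] on the right of the
   size condition. *)
have fle ts' ws B' : size ts' = size ws -> all (bnd K k) ts' -> {subset ws <= B'} ->
    (N + #|B'| + sumn [seq size (positions z) | z <- ts'] <= d + size ts')%N ->
    (\prod_(z <- ts') cnt N k z <= size (forest (embs k) ts' ws B'))%N.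
  elim: ts' ws B' => [|t ts' IHts] [|w ws] B' //=; first by rewrite big_nil.
  move=> [sw] /andP[bt bts] wsB le; rewrite big_cons.
  have wB : w \in B' by rewrite wsB ?mem_head.
  have tsle : (size ts' <= sumn [seq size (positions z) | z <- ts'])%N.
    by elim: ts' {IHts sw bts le} => //= -[ss] ts' IHts; rewrite size_positions; lia.
  apply: (@leq_trans (size (embs k t w B') * \prod_(z <- ts') cnt N k z)).
    by apply: leq_mul => //; apply: IH => //; lia.
  apply: size_allpairs_ge => tau taue; apply: IHts => //.
    by move=> x xws; rewrite inE wsB// in_cons xws orbT.
  have [shE _ _ _] := embsP wB taue.
  suff : (#|B' :|: [set x in labels tau]| <= #|B'| + (size (positions t)).-1)%N.
    case: t {bt taue shE} le => ss; rewrite size_positions => le1 le2; move: #|_ :|: _| #|B'| le1 le2 => m m1; move: (sumn _) (sumn _) => m3 m4; lia.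
  rewrite -shE -size_labels -size_behead.
  apply: (@leq_trans #|B' :|: [set x in behead (labels tau)]|); last first.
    by apply: leq_trans (leq_card_setU _ _) _; rewrite leq_add2l cardsE card_size.
  apply/subset_leq_card/fintype.subsetP => x; rewrite labelsE !inE (embs_root taue).
  by case/or3P => [->//|/eqP->|->]; rewrite ?wB ?orbT.
move=> /andP[_ bts] vB; rewrite size_positions => le /=.
apply: (@leq_trans (size (enum [set W : {set V} | (W \subset [set w | e v w] :\: B) && (#|W| == size ts)])
    * \prod_(z <- ts) cnt N k z)).
  apply: leq_mul => //; rewrite -cardE cards_draws; apply: leq_bin2l.
  have := cardsID B [set w | e v w]; rewrite reg_e.
  have : (#|[set w | e v w] :&: B| <= #|B|)%N := subset_leq_card (finset.subsetIr _ B).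
  move: #|_ :&: _| #|_ :\: _| #|B| (sumn _) le => c1 c2 c3 c4 le h1 h2; lia.
apply: size_allpairs_ge => W; rewrite mem_enum inE => /andP[_ /eqP Ws].
apply: fle => //; first by rewrite -cardE Ws.
  by move=> x; rewrite mem_enum inE => ->; rewrite orbT.
have h : (#|B :|: W| <= #|B| + #|W|)%N := leq_card_setU B W.
move: #|_ :|: _| #|B| #|W| (sumn _) Ws le h => c1 c2 c3 c4; lia.
Qed.

Section Probability.
Context {R : realType}.
Variables (p : R).
Hypotheses (p0 : 0 <= p) (p1 : p <= 1).

(* Lower bound for the probability of exploring a given copy of [t]. *)
Fixpoint wtp k t : R :=
  let: PNode ts := t in
  if k is k'.+1 then (1 - p) ^+ d * \prod_(s <- ts) (p * wtp k' s) else 1.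

Lemma wtp_gtree k tau : gtree k tau ->
  p ^+ size (tedges tau) * (1 - p) ^+ (d * size (inner k tau)) = wtp k (lshape tau).
Proof.
elim: k tau => [|k IH] [v ts]; first by case: ts => //= _; rewrite muln0 !expr0 mulr1.
move=> /= /and3P[_ _ gts]; rewrite mulnS exprD mulrCA; congr (_ * _).
elim: ts gts => [_|s ts IHts /andP[gs gts]] /=; first by rewrite big_nil muln0 mulr1.
rewrite big_cons -IHts// -IH// !size_cat ?addSn /= !mulnDr !exprS !exprD; ring.
Qed.

(** The event [ev tau] forces the exploration to be [tau], so these events are disjoint for distinct
    copies and their probabilities add up. *)
Lemma good_prob N K r t v : bnd K r t -> (N + size (positions t) <= d)%N ->
  (cnt N r t)%:R * wtp r t <= Ex p (edges e) (fun F => (good r t F v)%:R).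
Proof.
move=> bt Nd; have q0 : 0 <= 1 - p by rewrite subr_ge0.
have vv : v \in [set v] by rewrite inE.
have w0 : 0 <= wtp r t.
  elim: r t {bt Nd} => [|r IH] [ts] //=; rewrite mulr_ge0 ?exprn_ge0//.
  by apply: prodr_ge0 => s _; rewrite mulr_ge0.
pose ev tau F := [forall E in dom r tau, (E \in F) == (E \in tedges tau)].
apply: (@le_trans _ _ (\sum_(tau <- embs r t v [set v]) Ex p (edges e) (fun F => (ev tau F)%:R))).
  apply: (@le_trans _ _ (\sum_(tau <- embs r t v [set v]) wtp r t)).
    rewrite big_const_seq count_predT iter_addr_0 -[leRHS]mulr_natl.
    by apply: ler_wpM2r => //; rewrite ler_nat; apply: size_embs bt vv _; rewrite cards1; lia.
  rewrite big_seq [leRHS]big_seq; apply: ler_sum => tau taue.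
  have [<- gt _ _] := embsP vv taue; rewrite -(wtp_gtree gt).
  apply: le_trans (Ex_cylinder p0 p1 (tedges tau) _); last first.
    by apply/fintype.subsetP => E; rewrite inE => /andP[].
  apply: ler_wpM2l; first by rewrite exprn_ge0.
  by apply: ler_wiXn2l => //; [rewrite lerBlDr lerDl|exact: card_dom].
rewrite -Ex_sum; apply: le_Ex => // F FO.
have evX tau : tau \in embs r t v [set v] -> ev tau F -> Xp r F v = tau.
  move=> taue; have [_ gt ut _] := embsP vv taue.
  exact: Xp_gtree gt ut (embs_root taue) FO.
have [XE|XE] := boolP (Xp r F v \in embs r t v [set v]); last first.
  rewrite big1_seq ?ler0n// => tau /andP[_ taue].
  by case: (boolP (ev tau F)) => // /(evX _ taue) Xt; rewrite Xt taue in XE.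
rewrite (bigD1_seq (Xp r F v))//= ?uniq_embs// big1_seq ?addr0.
  have [shE _ ut _] := embsP vv XE.
  by rewrite /good shE eqxx ut /= lern1 leq_b1.
move=> tau /andP[nX taue]; case: (boolP (ev tau F)) => // /(evX _ taue) Xt.
by rewrite Xt eqxx in nX.
Qed.

End Probability.
End Regular.
End Embeddings.

(** * The Galton-Watson law *)

Fixpoint lists (T : Type) (n : nat) (s : seq T) : seq (seq T) :=
  if n is m.+1 then [seq x :: l | x <- s, l <- lists m s] else [:: [::]].

Lemma mem_lists (T : eqType) n (s : seq T) l :
  (l \in lists n s) = (size l == n) && all (mem s) l.
Proof.
elim: n l => [|n IH] [|x l] //=; first by apply/allpairsP => -[[y l'] []].
apply/allpairsP/andP => [[[y l'] /= [ys l's [-> ->]]]|[sl /andP[xs ls]]].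
  by move: l's; rewrite IH => /andP[/eqP-> ->]; rewrite ys.
by exists (x, l); rewrite /= IH ls andbT; split.
Qed.

Lemma uniq_lists (T : eqType) n (s : seq T) : uniq s -> uniq (lists n s).
Proof.
move=> us; elim: n => //= n IH; apply: allpairs_uniq => //.
by move=> [x l] [x' l'] _ _ /= [-> ->].
Qed.

Lemma size_lists (T : Type) n (s : seq T) : size (lists n s) = (size s ^ n)%N.
Proof. by elim: n => //= n IH; rewrite size_allpairs IH expnS. Qed.

Lemma sum_lists (R : comPzSemiRingType) (T : Type) n (s : seq T) (f : T -> R) :
  \sum_(l <- lists n s) \prod_(x <- l) f x = (\sum_(x <- s) f x) ^+ n.
Proof.
elim: n => [|n IH] /=; first by rewrite big_seq1 big_nil expr0.
rewrite big_allpairs_dep exprS mulr_suml; apply: eq_bigr => x _.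
by rewrite -IH mulr_sumr; apply: eq_bigr => l _; rewrite big_cons.
Qed.

Lemma bernoulli_ineq (R : realFieldType) (x : R) n : 0 <= x -> x <= 1 -> 1 - n%:R * x <= (1 - x) ^+ n.
Proof.
move=> x0 x1; elim: n => [|n IH]; first by rewrite mul0r subr0 expr0.
rewrite exprS; have q0 : 0 <= 1 - x by lra.
apply: le_trans (ler_wpM2l q0 IH).
have : 0 <= n%:R * (x * x) by rewrite mulr_ge0// mulr_ge0.
rewrite -[n.+1]addn1 natrD; lra.
Qed.

Lemma ler_sum_seq_subset (R : numDomainType) (T : eqType) (s s' : seq T) (f : T -> R) :
  uniq s -> uniq s' -> {subset s <= s'} -> (forall x, 0 <= f x) ->
  \sum_(x <- s) f x <= \sum_(x <- s') f x.
Proof.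
move=> us us' ss' f0; rewrite [leRHS](bigID (mem s)) /=.
have <- : \sum_(x <- s) f x = \sum_(x <- s' | mem s x) f x; last by rewrite lerDl sumr_ge0.
rewrite -[RHS]big_filter; apply: perm_big; apply: uniq_perm => //; first exact: filter_uniq.
by move=> x; rewrite mem_filter /=; case: (boolP (x \in s)) => // /ss' ->.
Qed.

Lemma expn_leqW m n k : (m <= n)%N -> (m ^ k <= n ^ k)%N.
Proof. by case: k => // k; rewrite leq_exp2r. Qed.

Fixpoint trees K r : seq ptree :=
  if r is k.+1 then [seq PNode l | n <- iota 0 K.+1, l <- lists n (trees K k)]
  else [:: PNode [::]].

Lemma mem_trees K r t : (t \in trees K r) = bnd K r t.
Proof.
elim: r t => [|k IH] [ts]; first by rewrite /= inE; apply/eqP/nilP => [[]|->].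
have -> : bnd K k.+1 (PNode ts) = (size ts <= K)%N && all (mem (trees K k)) ts.
  by rewrite /=; congr (_ && _); apply: eq_all => s; rewrite /= IH.
apply/allpairsPdep/andP => [[n [l [nK ll [->]]]]|[sK tsb]].
  by move: nK ll; rewrite mem_iota mem_lists add0n ltnS => /= nK /andP[/eqP-> ->].
by exists (size ts), ts; rewrite mem_iota add0n ltnS sK mem_lists eqxx.
Qed.

Lemma uniq_trees K r : uniq (trees K r).
Proof.
elim: r => // k IH; apply: allpairs_uniq_dep; first exact: iota_uniq.
  by move=> n _; exact: uniq_lists.
move=> [n l] [n' l'] /allpairsPdep[m [x [_ xm E]]] /allpairsPdep[m' [x' [_ x'm' E']]].
case: E xm => -> ->; case: E' x'm' => -> ->; rewrite !mem_lists.
by move=> /andP[/eqP<- _] /andP[/eqP<- _] [->].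
Qed.

(** With [m = (K+1)^k], the recursion gives at most [(K+1) ((K+1)^m)^K] trees, and
    [1 + K m <= (K+1) m]. *)
Lemma size_trees K r : (0 < K)%N -> (size (trees K r) <= K.+1 ^ (K.+1 ^ r))%N.
Proof.
move=> K0; elim: r => [|k IH]; first by rewrite /= expn0 expn1.
have -> : size (trees K k.+1) = (\sum_(n <- iota 0 K.+1) size (trees K k) ^ n)%N.
  rewrite size_allpairs_dep sumnE big_map; apply: eq_bigr => n _; exact: size_lists.
have st : (0 < size (trees K k))%N.
  have : PNode [::] \in trees K k by rewrite mem_trees; case: k {IH}.
  by case: (trees K k).
apply: (@leq_trans (\sum_(n <- iota 0 K.+1) size (trees K k) ^ K)%N).
  rewrite big_seq [leqRHS]big_seq; apply: leq_sum => n; rewrite mem_iota add0n ltnS /= => nK.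
  exact: leq_pexp2l.
rewrite big_const_seq count_predT size_iota iter_addn_0 mulnC.
apply: (@leq_trans (K.+1 * (K.+1 ^ (K.+1 ^ k)) ^ K)); first by rewrite leq_mul2l expn_leqW.
rewrite -expnM -expnS leq_exp2l// expnSr; have : (0 < K.+1 ^ k)%N by rewrite expn_gt0.
by move: (K.+1 ^ k)%N => m; nia.
Qed.

Section GaltonWatson.
Context {R : realType}.
Variables (c : R) (c0 : 0 < c).
Local Notation pmf := (poisson_pmf c).
Local Notation gw := (gw_law c).

Lemma pmfE n : pmf n = exp_coeff c n * expR (- c).
Proof. by rewrite /poisson_pmf c0 /exp_coeff. Qed.

Lemma pmf_sum_le1 K : \sum_(n <- iota 0 K) pmf n <= 1.
Proof.
rewrite (eq_bigr (fun n => exp_coeff c n * expR (- c))); last by move=> n _; rewrite pmfE.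
rewrite -mulr_suml -ler_pdivlMr ?expR_gt0// div1r expRN invrK.
have := nondecreasing_cvgn_le _ (is_cvg_series_exp_coeff c) K.
rewrite /expR /series /= /index_iota subn0; apply.
apply: nondecreasing_series => n _ _; exact: exp_coeff_ge0 (ltW c0).
Qed.

(** Chernoff bound [exp(-K) E[exp X]] for a Poisson variable [X] of mean [c]. *)
Definition ptail (K : nat) : R := expR (c * expR 1 - c - K%:R).

(** For [i > K] the factor [exp(i - K)] is at least 1, so the tail of the series of [exp c] is at
    most [exp(-K)] times the series of [exp(c e)]. *)
Lemma pmf_tail K : 1 - ptail K <= \sum_(n <- iota 0 K.+1) pmf n.
Proof.
rewrite [leRHS](eq_bigr (fun n => exp_coeff c n * expR (- c))); last by move=> n _; rewrite pmfE.
rewrite -mulr_suml; set S := \sum_(_ <- _) _.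
suff H : expR c <= S + expR (c * expR 1 - K%:R).
  have : expR c * expR (- c) <= (S + expR (c * expR 1 - K%:R)) * expR (- c).
    by apply: ler_wpM2r => //; exact: expR_ge0.
  rewrite -expRD subrr expR0 mulrDl -expRD /ptail.
  by rewrite (_ : c * expR 1 - K%:R - c = c * expR 1 - c - K%:R); [lra|ring].
have ce0 : 0 <= c * expR 1 by rewrite mulr_ge0 ?expR_ge0// ltW.
have partial_le n : series (exp_coeff (c * expR 1)) n <= expR (c * expR 1).
  apply: nondecreasing_cvgn_le; last exact: is_cvg_series_exp_coeff.
  by apply: nondecreasing_series => m _ _; exact: exp_coeff_ge0.
rewrite {1}/expR; apply: limr_le; first exact: is_cvg_series_exp_coeff.
near=> n.
apply: (@le_trans _ _ (S + expR (- K%:R) * series (exp_coeff (c * expR 1)) n)); last first.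
  by rewrite lerD2l [c * _ - _]addrC expRD; apply: ler_wpM2l; rewrite ?expR_ge0.
rewrite /series /= mulr_sumr.
apply: (@le_trans _ _ (\sum_(0 <= i < n) ((i < K.+1)%N%:R * exp_coeff c i + expR (- K%:R) * exp_coeff (c * expR 1) i))).
  apply: ler_sum => i _; have [iK|Ki] := ltnP i K.+1.
    by rewrite mul1r lerDl mulr_ge0 ?expR_ge0// exp_coeff_ge0.
  have -> : exp_coeff (c * expR 1) i = exp_coeff c i * expR i%:R.
    by rewrite /exp_coeff /= exprMn -expRM_natl mulr1 mulrAC.
  rewrite mul0r add0r mulrCA -expRD; apply: ler_peMr; first by rewrite exp_coeff_ge0// ltW.
  by apply: le_trans (expR_ge1Dx _); rewrite lerDl addrC subr_ge0 ler_nat; lia.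
rewrite big_split /= lerD2r /S.
have -> : \sum_(0 <= i < n) (i < K.+1)%N%:R * exp_coeff c i =
   \sum_(i <- [seq i <- iota 0 n | (i < K.+1)%N]) exp_coeff c i.
  rewrite big_filter [RHS]big_mkcond /index_iota subn0; apply: eq_bigr => i _.
  by case: ifP => _; rewrite ?mul1r ?mul0r.
apply: ler_sum_seq_subset => //; rewrite ?filter_uniq ?iota_uniq//.
  by move=> i; rewrite mem_filter !mem_iota /= => /andP[->].
by move=> i; rewrite exp_coeff_ge0// ltW.
Unshelve. all: by end_near. Qed.

Lemma gw_ge0 r t : 0 <= gw r t.
Proof.
elim: r t => [|k IH] [ts] /=; first by case: ts.
by rewrite mulr_ge0 ?poisson_pmf_ge0//; apply: prodr_ge0.
Qed.

Definition gmass K r : R := \sum_(t <- trees K r) gw r t.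

Lemma gmass_ge0 K r : 0 <= gmass K r.
Proof. by apply: sumr_ge0 => t _; exact: gw_ge0. Qed.

(** Branching recursion: the truncated generating function of the offspring law, evaluated at the
    previous mass. *)
Lemma gmassS K r : gmass K r.+1 = \sum_(n <- iota 0 K.+1) pmf n * gmass K r ^+ n.
Proof.
rewrite /gmass big_allpairs_dep; apply: eq_bigr => n _.
rewrite -sum_lists mulr_sumr big_seq [RHS]big_seq; apply: eq_bigr => l.
by rewrite mem_lists => /andP[/eqP ln _] /=; rewrite ln.
Qed.

Lemma gmass_le1 K r : gmass K r <= 1.
Proof.
elim: r => [|r IH]; first by rewrite /gmass big_seq1.
rewrite gmassS; apply: le_trans (pmf_sum_le1 K.+1); apply: ler_sum => n _.
by rewrite ler_piMr ?poisson_pmf_ge0// exprn_ile1 ?gmass_ge0.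
Qed.

(** Each term [n * pmf n] with [n > 0] equals [c * pmf (n - 1)]. *)
Lemma pmf_mean K : \sum_(n <- iota 0 K.+1) n%:R * pmf n <= c.
Proof.
rewrite /= big_cons mul0r add0r (iotaDl 1 0) big_map.
apply: le_trans (_ : c * \sum_(n <- iota 0 K) pmf n <= _); last first.
  by rewrite ler_piMr ?pmf_sum_le1// ltW.
rewrite mulr_sumr; apply: ler_sum => n _; rewrite !pmfE /exp_coeff /= add1n factS exprS natrM.
have n0 : n.+1%:R != 0 :> R by rewrite pnatr_eq0.
have f0 : n`!%:R != 0 :> R by rewrite pnatr_eq0 -lt0n fact_gt0.
rewrite le_eqVlt; apply/orP; left; apply/eqP.
by move: n.+1%:R n`!%:R n0 f0 => u w u0 w0; field; rewrite u0 w0.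
Qed.

(** A union bound over individuals: generation [i] has mean size [c^i], and each individual has more
    than [K] children with probability at most [ptail K]. In the recursion, Bernoulli's inequality
    linearizes [g^n] around 1. *)
Lemma gmass_tail K r : 1 - gmass K r <= (\sum_(i < r) c ^+ i) * ptail K.
Proof.
elim: r => [|r IH]; first by rewrite /gmass big_seq1 big_ord0 mul0r /= subrr.
set g := gmass K r in IH *.
have g0 : 0 <= g := gmass_ge0 K r.
have g1 : g <= 1 := gmass_le1 K r.
have H : \sum_(n <- iota 0 K.+1) pmf n - c * (1 - g) <= gmass K r.+1.
  rewrite gmassS -/g.
  apply: (@le_trans _ _ (\sum_(n <- iota 0 K.+1) (pmf n - (n%:R * pmf n) * (1 - g)))).
    rewrite sumrB lerD2l lerN2 -mulr_suml; apply: ler_wpM2r; first by rewrite subr_ge0.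
    exact: pmf_mean.
  apply: ler_sum => n _.
  have -> : pmf n - n%:R * pmf n * (1 - g) = pmf n * (1 - n%:R * (1 - g)) by ring.
  apply: ler_wpM2l; first exact: poisson_pmf_ge0.
  have := @bernoulli_ineq R (1 - g) n; rewrite opprB addrCA subrr addr0; apply; lra.
have := pmf_tail K; rewrite big_ord_recl expr0.
rewrite (eq_bigr (fun i : 'I_r => c * c ^+ i)); last by move=> i _; rewrite -exprS.
rewrite -mulr_sumr mulrDl mul1r -mulrA; have := ler_wpM2l (ltW c0) IH; lra.
Qed.

Lemma bnd_mono K K' r t : (K <= K')%N -> bnd K r t -> bnd K' r t.
Proof.
move=> KK'; elim: r t => // k IH [ts] /= /andP[tK /allP H].
by rewrite (leq_trans tK KK'); apply/allP => s /H; exact: IH.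
Qed.

Lemma bnd_exists_all r (ts : seq ptree) :
  (forall t, t \in ts -> exists K, bnd K r t) -> exists K, all (bnd K r) ts.
Proof.
elim: ts => [|t ts IH] H; first by exists 0%N.
have [K tK] := H t (mem_head _ _); have [|K' tsK] := IH.
  by move=> s sts; apply: H; rewrite in_cons sts orbT.
exists (maxn K K'); rewrite /= (bnd_mono _ tK) ?leq_maxl//=.
by apply/allP => s /(allP tsK); apply: bnd_mono; exact: leq_maxr.
Qed.

Lemma bnd_gw r t : gw r t != 0 -> exists K, bnd K r t.
Proof.
elim: r t => [|k IH] [ts] /=; first by case: ts => [_|? ?]; [exists 0%N|rewrite eqxx].
rewrite mulf_eq0 negb_or prodf_seq_neq0 => /andP[_ /allP H].
have [|K HK] := @bnd_exists_all k ts; first by move=> s /H/IH.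
exists (maxn K (size ts)); rewrite leq_maxr /=.
by apply/allP => s /(allP HK); apply: bnd_mono; exact: leq_maxl.
Qed.

(** After removal of the trees of weight zero, a finite list lies in [trees K r] for some [K]. *)
Lemma gw_sum_le1 r (s : seq ptree) : uniq s -> \sum_(t <- s) gw r t <= 1.
Proof.
move=> us; pose s' := [seq t <- s | gw r t != 0].
have -> : \sum_(t <- s) gw r t = \sum_(t <- s') gw r t.
  by rewrite big_filter [RHS]big_mkcond; apply: eq_bigr => t _; case: eqP.
have [|K HK] := @bnd_exists_all r s'.
  by move=> t; rewrite mem_filter => /andP[/bnd_gw].
apply: le_trans (gmass_le1 K r); apply: ler_sum_seq_subset; rewrite ?filter_uniq ?uniq_trees//.
  by move=> t /(allP HK); rewrite mem_trees.
exact: gw_ge0.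
Qed.

Lemma gw_le1 r t : gw r t <= 1.
Proof. by have := @gw_sum_le1 r [:: t] isT; rewrite big_seq1. Qed.

(** * Poisson approximation at a node and along a tree *)

Section NodeBound.
Variables (d N K : nat).
Hypotheses (d0 : (0 < d)%N) (Nd : (N <= d)%N) (cd : c <= d%:R).
Let p := c / d%:R.
(* Relative error, per vertex of the tree, of the Poisson approximation. *)
Definition eta : R := ((K * (d - N + K))%:R + c ^+ 2) / d%:R.

Let dR : 0 < d%:R :> R. Proof. by rewrite ltr0n. Qed.
Let p0 : 0 <= p. Proof. by rewrite divr_ge0// ltW. Qed.
Let p1 : p <= 1. Proof. by rewrite ler_pdivrMr// mul1r. Qed.

(** [(1 - p) exp p >= 1 - p^2]; the [d]-th power costs [d p^2 = c^2 / d]. *)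
Lemma one_sub_exp : 1 - c ^+ 2 / d%:R <= (1 - p) ^+ d * expR c.
Proof.
have -> : expR c = expR p ^+ d.
  by rewrite -expRM_natl mulrC /p mulfVK// gt_eqF.
rewrite -exprMn.
have x1 : p ^+ 2 <= 1 by rewrite exprn_ile1.
apply: (@le_trans _ _ ((1 - p ^+ 2) ^+ d)).
  apply: le_trans (bernoulli_ineq d (sqr_ge0 p) x1).
  rewrite lerD2l lerN2 /p expr_div_n le_eqVlt; apply/orP; left; apply/eqP.
  by field; rewrite gt_eqF.
apply: lerXn2r; rewrite ?nnegrE; first by rewrite subr_ge0.
  by rewrite mulr_ge0 ?expR_ge0// subr_ge0.
have := expR_ge1Dx p => h; have : (1 - p) * (1 + p) <= (1 - p) * expR p.
  by apply: ler_wpM2l => //; rewrite subr_ge0.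
by apply: le_trans; rewrite le_eqVlt; apply/orP; left; apply/eqP; ring.
Qed.

Lemma ffact_ge n j : ((n - j) ^ j <= n ^_ j)%N.
Proof.
elim: j => [|j IH]; first by rewrite expn0 ffactn0.
rewrite expnSr ffactnSr; apply: leq_mul; last by rewrite leq_sub2l.
by apply: leq_trans IH; apply: expn_leqW; rewrite leq_sub2l.
Qed.

Lemma binom_ge j : (j <= K)%N ->
  1 - (K * (d - N + K))%:R / d%:R <= 'C(N, j)%:R * j`!%:R / d%:R ^+ j :> R.
Proof.
move=> jK; have r0 : 0 <= 'C(N, j)%:R * j`!%:R / d%:R ^+ j :> R.
  by rewrite divr_ge0 ?exprn_ge0// mulr_ge0.
(* For [j > N] the left side is at most 0, since then [K >= 1] and [d - N + K >= d]. *)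
have [jN|Nj] := leqP j N; last first.
  apply: le_trans r0; rewrite subr_le0 ler_pdivlMr// mul1r ler_nat; nia.
rewrite -natrM bin_ffact.
pose x : R := (d - N + j)%:R / d%:R.
have xE : (N - j)%:R / d%:R = 1 - x.
  have de : (N - j)%:R + (d - N + j)%:R = d%:R :> R by rewrite -natrD; congr _%:R; lia.
  apply: (@mulIf _ d%:R); first by rewrite gt_eqF.
  by rewrite /x mulrBl mul1r !divfK ?gt_eqF// -de addrK.
apply: (@le_trans _ _ ((1 - x) ^+ j)); last first.
  rewrite -xE expr_div_n; apply: ler_wpM2r; first by rewrite invr_ge0 exprn_ge0.
  by rewrite -natrX ler_nat ffact_ge.
have x0 : 0 <= x by rewrite divr_ge0.
have x1 : x <= 1 by rewrite -subr_ge0 -xE divr_ge0.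
apply: le_trans (bernoulli_ineq j x0 x1).
rewrite lerD2l lerN2 /x mulrA; apply: ler_wpM2r; first by rewrite invr_ge0 ltW.
by rewrite -natrM ler_nat; nia.
Qed.

(** The errors of the binomial coefficient and of [(1 - p)^d] combine through
    [(1 - x)(1 - y) >= 1 - x - y]. *)
Lemma node_bound j : (j <= K)%N ->
  (1 - eta) * pmf j <= 'C(N, j)%:R * (p ^+ j * (1 - p) ^+ d).
Proof.
move=> jK; have A := binom_ge jK; have B := one_sub_exp.
have -> : 'C(N, j)%:R * (p ^+ j * (1 - p) ^+ d) =
    (('C(N, j)%:R * j`!%:R / d%:R ^+ j) * ((1 - p) ^+ d * expR c)) * pmf j.
  have f0 : j`!%:R != 0 :> R by rewrite pnatr_eq0 -lt0n fact_gt0.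
  have e0 : expR c != 0 by rewrite gt_eqF ?expR_gt0.
  have dj : d%:R ^+ j != 0 :> R by rewrite expf_neq0// gt_eqF.
  rewrite pmfE /exp_coeff /= expRN /p expr_div_n; move: ((1 - _) ^+ d) => q.
  by field; rewrite f0 e0 dj.
apply: ler_wpM2r; first exact: poisson_pmf_ge0.
move: A B; rewrite /eta mulrDl; set a := _ / d%:R ^+ j; set b := _ * expR c.
set x := _ / d%:R; set y := _ / d%:R => A B.
have a0 : 0 <= a by rewrite divr_ge0 ?exprn_ge0// mulr_ge0.
have b0 : 0 <= b by rewrite mulr_ge0 ?expR_ge0// exprn_ge0// subr_ge0.
have x0 : 0 <= x by rewrite divr_ge0.
have y0 : 0 <= y by rewrite divr_ge0 ?sqr_ge0.
have [h|h] := leP (1 - (x + y)) 0; first by apply: le_trans h _; rewrite mulr_ge0.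
have : (1 - x) * (1 - y) <= a * b by apply: ler_pM => //; lra.
by apply: le_trans; have := mulr_ge0 x0 y0; lra.
Qed.

(** The node bounds are multiplied along the tree. The factors for the last generation only weaken
    the estimate. *)
Lemma tree_bound k t : 0 <= 1 - eta -> bnd K k t ->
  (1 - eta) ^+ size (positions t) * gw k t <= (cnt N k t)%:R * wtp d p k t.
Proof.
move=> h0; have h1 : 1 - eta <= 1.
  by rewrite lerBlDr lerDl divr_ge0// addr_ge0 ?sqr_ge0.
elim: k t => [|k IH] [ts]; first by case: ts => //= _; rewrite !mulr1 expr1.
rewrite size_positions /= => /andP[tsK bts].
have -> : \prod_(s <- ts) (p * wtp d p k s) = p ^+ size ts * \prod_(s <- ts) wtp d p k s.
  by rewrite big_split /= big_const_seq count_predT iter_mulr_1.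
rewrite natrM natr_prod.
set P1 := \prod_(s <- ts) gw k s; set P2 := \prod_(s <- ts) (cnt N k s)%:R; set P3 := \prod_(s <- ts) wtp d p k s.
have -> : ('C(N, size ts)%:R * P2) * ((1 - p) ^+ d * (p ^+ size ts * P3)) =
  ('C(N, size ts)%:R * (p ^+ size ts * (1 - p) ^+ d)) * (P2 * P3) by ring.
rewrite exprS.
set m := sumn _.
have -> : (1 - eta) * (1 - eta) ^+ m * (pmf (size ts) * P1) =
  ((1 - eta) * pmf (size ts)) * ((1 - eta) ^+ m * P1) by ring.
apply: ler_pM; rewrite ?mulr_ge0 ?poisson_pmf_ge0 ?exprn_ge0//.
- by apply: prodr_ge0 => s _; exact: gw_ge0.
- exact: node_bound.
rewrite /P1 /P2 /P3 -big_split /= {}/m {P1 P2 P3 tsK}.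
elim: ts bts => [_|s ts IHts /andP[bs bts]]; first by rewrite !big_nil expr0 mulr1.
rewrite !big_cons /= exprD mulrACA; apply: ler_pM; rewrite ?mulr_ge0 ?exprn_ge0 ?gw_ge0//.
- by apply: prodr_ge0 => z _; exact: gw_ge0.
- exact: IH.
- exact: IHts.
Qed.

End NodeBound.

(** Instance [N := d - M], where [M = (K+1)^r] bounds the number of vertices of [t]. *)
Lemma good_prob_gw (V : finType) (e : rel V) (d K r : nat) t v :
  symmetric e -> (forall x, #|[set w | e x w]| = d) -> (0 < d)%N -> c <= d%:R ->
  (K.+1 ^ r <= d)%N -> bnd K r t ->
  gw r t - (K.+1 ^ r)%:R * (((K * (K.+1 ^ r + K))%:R + c ^+ 2) / d%:R) <=
  Ex (c / d%:R) (edges e) (fun F => (good r t F v)%:R).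
Proof.
move=> sym_e reg_e d0 cd Md bt; set M := (K.+1 ^ r)%N in Md *.
have dR : 0 < d%:R :> R by rewrite ltr0n.
have p0 : 0 <= c / d%:R by rewrite divr_ge0// ltW.
have p1 : c / d%:R <= 1 by rewrite ler_pdivrMr// mul1r.
have Nd : (d - M <= d)%N := leq_subr _ _.
have MM : (size (positions t) <= M)%N := size_positions_bnd bt.
have etaE : ((K * (M + K))%:R + c ^+ 2) / d%:R = eta d (d - M) K.
  by rewrite /eta subKn.
rewrite etaE; set h := eta _ _ _.
have h0 : 0 <= h by rewrite divr_ge0// addr_ge0 ?sqr_ge0.
(* If [h > 1], the left side is at most 0 because [gw] is at most 1. *)
have [h1|h1] := leP h 1; last first.
  apply: le_trans (Ex_ge0 p0 p1 _); last by move=> F _.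
  rewrite subr_le0; apply: le_trans (gw_le1 r t) _.
  by apply: mulr_ege1; [rewrite ler1n expn_gt0|exact: ltW].
have H : (d - M + size (positions t) <= d)%N by lia.
apply: le_trans (good_prob sym_e reg_e p0 p1 v bt H).
apply: le_trans (tree_bound d0 Nd cd _ bt); last by rewrite subr_ge0.
rewrite -/h; have g0 := gw_ge0 r t; have g1 := gw_le1 r t.
have B := bernoulli_ineq (size (positions t)) h0 h1.
have : (1 - M%:R * h) * gw r t <= (1 - h) ^+ size (positions t) * gw r t.
  apply: ler_wpM2r => //; apply: le_trans B; rewrite lerD2l lerN2.
  by apply: ler_wpM2r => //; rewrite ler_nat.
apply: le_trans; rewrite mulrBl mul1r lerD2l lerN2 ler_piMr// mulr_ge0//.
Qed.

End GaltonWatson.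

Local Open Scope classical_set_scope.
Local Open Scope ring_scope.

(** * Total variation distance *)

Lemma rg_iso_refl G : rg_iso G G.
Proof. by exists id; split => //; exists id. Qed.

Lemma in_classE G A : rclass A -> in_class G A ->
  A = [set y | rg_iso (rg_of_code y) G].
Proof.
move=> [x [_ ->]] [z /= zx Gz]; have Gx := rg_iso_trans Gz zx.
apply/seteqP; split=> y /= h; first exact: rg_iso_trans h (rg_iso_sym Gx).
exact: rg_iso_trans h Gx.
Qed.

Lemma in_class_iso G H A : rg_iso G H -> in_class H A -> in_class G A.
Proof. by move=> GH [x Ax Hx]; exists x => //; exact: rg_iso_trans GH Hx. Qed.

Lemma in_class_exists G : symmetric (@rg_adj G) -> irreflexive (@rg_adj G) ->
  exists A, rclass A /\ in_class G A.
Proof.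
case: G => T adj r /= sym irr.
have T0 : (0 < #|T|)%N by apply/card_gt0P; exists r.
have h : #|T| = #|T|.-1.+1 by rewrite prednK.
pose f0 x := cast_ord h (enum_rank x).
(* Codes have their root at [ord0]; the transposition moves it there. *)
pose f x := tperm (f0 r) ord0 (f0 x).
have bf : bijective f.
  exists (fun i => enum_val (cast_ord (esym h) (tperm (f0 r) ord0 i))) => x.
    by rewrite /f tpermK /f0 cast_ordK enum_rankK.
  by rewrite /f /f0 enum_valK cast_ordKV tpermK.
have [g fK gK] := bf.
pose x : rcode := existT _ #|T|.-1 [ffun ij => adj (g ij.1) (g ij.2)].
have ix : rg_iso (RGraph adj r) (rg_of_code x).
  exists f; split=> //=; first by rewrite /f tpermL.
  by move=> y z; rewrite ffunE /= !fK.
exists [set y | rg_iso (rg_of_code y) (rg_of_code x)]; split; last first.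
  by exists x => //=; exact: rg_iso_refl.
exists x; split=> //; split=> [i j|i] /=; rewrite !ffunE /=; first exact: sym.
by rewrite irr.
Qed.

Lemma tadj_sym : symmetric tadj.
Proof. by move=> x y; rewrite /tadj orbC. Qed.

Lemma tadj_irr : irreflexive tadj.
Proof. by move=> x; rewrite /tadj orbb (_ : _ == _ = false)//; apply/eqP; lia. Qed.

Lemma ptree_class t : exists A, rclass A /\ in_class (rg_of_ptree t) A.
Proof.
by apply: in_class_exists => [x y|x] /=; [exact: tadj_sym|exact: tadj_irr].
Qed.

Lemma in_set_asbool (T : Type) (P : T -> Prop) x : (x \in [set y | P y]) = `[< P x >].
Proof. by apply/idP/idP => [|/asboolP h]; rewrite inE // => /asboolP. Qed.

Section Classes.
Context {R : realType}.
Local Open Scope ereal_scope.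

Lemma esum_one_class G (x : \bar R) : 0 <= x ->
  (exists A, rclass A /\ in_class G A) ->
  \esum_(A in rclass) (if `[< in_class G A >] then x else 0) = x.
Proof.
move=> x0 [A0 [cA0 GA0]].
rewrite (eq_esum (b := fun A => if A \in [set A | in_class G A] then x else 0)); last first.
  by move=> A _; rewrite in_set_asbool.
rewrite -esum_mkcondr (_ : rclass `&` _ = [set A0]) ?esum_set1//.
apply/seteqP; split=> [A [cA GA]|A ->] //=.
by rewrite (in_classE cA GA) (in_classE cA0 GA0).
Qed.

(** A graph lies in at most one class, so the pairs of a class and a member project injectively to
    the member. *)
Lemma esum_classes (T : choiceType) (G : T -> Defs.rgraph) (w : T -> \bar R) :
  (forall t, 0 <= w t) ->
  \esum_(A in rclass) \esum_(t in [set t | in_class (G t) A]) w t <= \esum_(t in setT) w t.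
Proof.
move=> w0; rewrite esum_esum//.
pose U := [set t | exists2 A, rclass A & in_class (G t) A].
apply: (@le_trans _ _ (\esum_(t in U) w t)).
  rewrite (@reindex_esum _ _ _ (rclass `*`` (fun A => [set t | in_class (G t) A])) U snd) //.
  split.
  - by move=> [A t] [/= cA tA]; exists A.
  - move=> [A t] [A' t']; rewrite !inE => -[/= cA tA] [/= cA' tA'] tt'; subst t'.
    by rewrite (in_classE cA tA) (in_classE cA' tA').
  - by move=> t [A cA tA]; exists (A, t).
rewrite esum_mkcond; apply: le_esum => t _; by case: ifP.
Qed.

Lemma sum_le_esum (T : choiceType) (s : seq T) (w : T -> \bar R) : uniq s ->
  \sum_(t <- s) w t <= \esum_(t in setT) w t.
Proof.
move=> us; apply: esum_ge; exists [set` s]; first by split => //; exact: finite_seq.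
by rewrite -fsbig_seq.
Qed.

Lemma esum_gw_le1 (c : R) r : (0 < c)%R -> \esum_(t in setT) (gw_law c r t)%:E <= 1%:E.
Proof.
move=> c0; apply: ge_ereal_sup => _ [X [finX _] <-].
rewrite fsbig_finite//= sumEFin lee_fin; apply: gw_sum_le1 => //; exact: finmap.fset_uniq.
Qed.

End Classes.

Section TotalVariation.
Context {R : realType}.
Variables (c : R) (c0 : 0 < c) (V : finType) (V0 : (0 < #|V|)%N).
Implicit Types (F : {set {set V}}) (t : ptree).
Local Notation n := (#|V|%:R : R).
Local Notation gw := (gw_law c).

Let n0 : 0 < n. Proof. by rewrite ltr0n. Qed.

Lemma mu_empE (a : rel V) r A :
  mu_emp a r A = \sum_(v : V) (`[< in_class (Defs.ball a r v) A >])%:R / n.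
Proof.
rewrite /mu_emp -mulr_suml; congr (_ / _); rewrite -natr_sum; congr _%:R.
by rewrite -sum1_card big_mkcond /=; apply: eq_bigr => v _; rewrite inE; case: asbool.
Qed.

Definition bad r F v := [exists E in F, extra r F v E].

(** Frequency of the vertices whose ball is certified to be [t] by their exploration. *)
Definition flow r t F : R := #|[set v | good r t F v & ~~ bad r F v]%SET|%:R / n.

(** A vertex counts for one plane tree only, the shape of its exploration, even when several plane
    trees represent the same class. *)
Lemma sum_flow_le r s F A : uniq s ->
  \sum_(t <- s | `[< in_class (rg_of_ptree t) A >]) flow r t F <= mu_emp (sub_adj F) r A.
Proof.
move=> us; rewrite mu_empE /flow.
rewrite (eq_bigr (fun t => \sum_(v : V) (good r t F v && ~~ bad r F v)%:R / n)); last first.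
  move=> t _; rewrite -mulr_suml; congr (_ / _); rewrite -natr_sum; congr _%:R.
  by rewrite -sum1_card big_mkcond /=; apply: eq_bigr => v _; rewrite inE; case: (_ && _).
rewrite exchange_big /=; apply: ler_sum => v _; rewrite -mulr_suml.
apply: ler_wpM2r; first by rewrite invr_ge0 ltW.
pose X := lshape (Xp r F v).
have goodX t : good r t F v -> t = X by move=> /andP[/eqP].
have [/andP[gX bX]|nX] := boolP (good r X F v && ~~ bad r F v); last first.
  rewrite big1// => t _; case: (boolP (_ && _)) => // /andP[gdt bt].
  by have tX := goodX _ gdt; rewrite tX in gdt; rewrite gdt bt in nX.
have [XA|nXA] := boolP `[< in_class (rg_of_ptree X) A >]; last first.
  rewrite big1// => t tA; case: (boolP (_ && _)) => // /andP[/goodX tX _].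
  by rewrite tX (negbTE nXA) in tA.
have -> : `[< in_class (Defs.ball (sub_adj F) r v) A >] = true.
  apply/asboolP; move/asboolP: XA; apply: in_class_iso; apply: rg_iso_sym.
  apply: good_ball_iso gX _ => E EF; apply: contra bX => ex; apply/existsP; exists E.
  by rewrite EF.
have [Xs|nXs] := boolP (X \in s); last first.
  rewrite big1_seq// => t /andP[_ ts]; case: (boolP (_ && _)) => // /andP[/goodX tX _].
  by rewrite -tX ts in nXs.
rewrite (big_rem X)//= XA gX bX big1_seq ?addr0// => t /andP[_].
rewrite (rem_filter _ us) mem_filter => /andP[/= tX _].
by case: (boolP (_ && _)) => // /andP[/goodX tX' _]; rewrite tX' eqxx in tX.
Qed.

Local Open Scope ereal_scope.

Lemma mu_gw_le1 r A : mu_gw c r A <= 1%:E.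
Proof.
apply: le_trans (esum_gw_le1 r c0); rewrite /mu_gw esum_mkcond; apply: le_esum => t _.
by case: ifP => // _; rewrite lee_fin gw_ge0.
Qed.

Lemma mu_gw_ge0 r A : 0 <= mu_gw c r A.
Proof. by apply: esum_ge0 => t _; rewrite lee_fin gw_ge0. Qed.

Lemma mu_gw_fin r A : exists2 x : R, (0 <= x)%R & mu_gw c r A = x%:E.
Proof.
have := mu_gw_le1 r A; have := mu_gw_ge0 r A.
by case: (mu_gw c r A) => [x||]//; rewrite !lee_fin => x0 _; exists x.
Qed.

Lemma mu_emp_ge0 (a : rel V) r A : (0 <= mu_emp a r A :> R)%R.
Proof. by rewrite /mu_emp divr_ge0. Qed.

Lemma esum_mu_emp F r : \esum_(A in rclass) (mu_emp (sub_adj F) r A)%:E = 1%:E :> \bar R.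
Proof.
rewrite (eq_esum (b := fun A => \sum_(v : V)
  (if `[< in_class (Defs.ball (sub_adj F) r v) A >] then (n^-1)%:E else 0))); last first.
  move=> A _; rewrite mu_empE -sumEFin; apply: eq_bigr => v _.
  by case: asbool; rewrite ?mul1r ?mul0r.
rewrite esum_sum; last first.
  by move=> A v _ _; case: ifP => // _; rewrite lee_fin invr_ge0.
rewrite (eq_bigr (fun=> (n^-1)%:E)); last first.
  move=> v _; apply: esum_one_class; first by rewrite lee_fin invr_ge0.
  by apply: in_class_exists => [x y|x] /=; [exact: sub_adj_sym|exact: sub_adj_irr].
by rewrite sumEFin big_const iter_addr_0 -[(_ *+ _)%R]mulr_natl divff// gt_eqF.
Qed.

Lemma esum_mu_gw r : \esum_(A in rclass) mu_gw c r A <= 1%:E.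
Proof.
apply: le_trans (esum_gw_le1 r c0).
by apply: (esum_classes (fun t => rg_of_ptree t)) => t; rewrite lee_fin gw_ge0.
Qed.

(** The minima, pushed forward to classes, form a common minorant of both laws, and each law has
    mass at most 1. *)
Lemma dTV_le K r F : dTV (mu_emp (sub_adj F) r) (mu_gw c r) <=
  (1 - \sum_(t <- trees K r) Num.min (gw r t) (flow r t F))%:E.
Proof.
pose m t := Num.min (gw r t) (flow r t F).
have m0 t : (0 <= m t)%R by rewrite le_min gw_ge0//= /flow divr_ge0.
pose h A := \sum_(t <- trees K r) (if `[< in_class (rg_of_ptree t) A >] then (m t)%:E else 0).
have hE A : h A = (\sum_(t <- trees K r | `[< in_class (rg_of_ptree t) A >]) m t)%:E.
  by rewrite -sumEFin [RHS]big_mkcond.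
have h0 A : 0 <= h A by rewrite hE lee_fin sumr_ge0.
have h_emp A : h A <= (mu_emp (sub_adj F) r A)%:E.
  rewrite hE lee_fin; apply: le_trans (sum_flow_le r F A (uniq_trees K r)).
  by apply: ler_sum => t _; rewrite ge_min lexx orbT.
have h_gw A : h A <= mu_gw c r A.
  rewrite /mu_gw esum_mkcond; apply: le_trans (sum_le_esum _ (uniq_trees K r)).
  apply: lee_sum => t _; rewrite in_set_asbool.
  by case: asbool => //; rewrite lee_fin ge_min lexx.
have hS : \esum_(A in rclass) h A = (\sum_(t <- trees K r) m t)%:E.
  rewrite esum_sum; last by move=> A t _ _; case: ifP => // _; rewrite lee_fin.
  rewrite -sumEFin; apply: eq_bigr => t _; apply: esum_one_class; first by rewrite lee_fin.
  exact: ptree_class.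
set S := (\sum_(t <- trees K r) m t)%R in hS *.
(* Pointwise [|y - x| + 2 z <= x + y] whenever [z] is at most [x] and [y]. Stated additively, the
   sums over classes need no subtraction. *)
have key : \esum_(A in rclass) `|(mu_emp (sub_adj F) r A)%:E - mu_gw c r A| + (S + S)%:E
    <= (1 + 1)%:E.
  rewrite !EFinD -hS -{1}(esum_mu_emp F r).
  apply: (@le_trans _ _ (\esum_(A in rclass) (mu_emp (sub_adj F) r A)%:E
    + \esum_(A in rclass) mu_gw c r A)); last first.
    by rewrite leeD2l// esum_mu_gw.
  rewrite -!esumD//; do ?by move=> A _;
    rewrite ?mu_gw_ge0// ?adde_ge0// lee_fin mu_emp_ge0.
  apply: le_esum => A cA; have [x x0 xE] := mu_gw_fin r A.
  have := h_emp A; have := h_gw A; rewrite xE hE -EFinB.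
  rewrite abse_EFin -!EFinD !lee_fin.
  set y := mu_emp _ _ _; set z := (\sum_(_ <- _ | _) _)%R => zx zy.
  by case: (lerP 0 (y - x)) => yx; [rewrite ger0_norm//|rewrite ltr0_norm//]; lra.
rewrite /dTV.
have : \esum_(A in rclass) `|(mu_emp (sub_adj F) r A)%:E - mu_gw c r A| <= (2 - (S + S))%:E.
  by rewrite EFinB leeBrDr// (_ : 2 = 1 + 1)%R.
move=> le2; apply: (@le_trans _ _ ((2^-1)%:E * (2 - (S + S))%:E)); last by rewrite -EFinM lee_fin; lra.
by apply: lee_wpmul2l.
Qed.

Lemma le_dTV F r A : rclass A ->
  `|(mu_emp (sub_adj F) r A)%:E - mu_gw c r A| <= 2%:E * dTV (mu_emp (sub_adj F) r) (mu_gw c r).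
Proof.
move=> cA; rewrite /dTV muleA -EFinM divff// mul1e.
apply: le_trans (_ : \esum_(A' in [set A]) `|(mu_emp (sub_adj F) r A')%:E - mu_gw c r A'| <= _).
  by rewrite esum_set1.
rewrite esum_mkcond [leRHS]esum_mkcond; apply: le_esum => A' _.
case: ifPn => [|_]; last by case: ifP.
by rewrite inE => ->; rewrite mem_set.
Qed.

End TotalVariation.

(** * A non-asymptotic bound *)

Lemma perc_probE (R : realType) (V : finType) (e : rel V) (p : R) (Q : {set {set V}} -> bool) :
  perc_prob e p Q = Ex p (edges e) (fun F => (Q F)%:R).
Proof.
rewrite /perc_prob /Ex big_mkcondr /=; apply: eq_bigr => F _; rewrite /perc_weight.
by case: (Q F); rewrite ?mulr1 ?mulr0.
Qed.

Section NonAsymptotic.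
Context {R : realType}.
Variables (c : R) (V : finType) (e : rel V) (d : nat).
Hypotheses (c0 : 0 < c) (sym_e : symmetric e) (reg_e : forall v, #|[set w | e v w]%SET| = d).
Hypotheses (V0 : (0 < #|V|)%N) (d0 : (0 < d)%N) (cd : c <= d%:R).
Local Notation n := (#|V|%:R : R).
Local Notation p := (c / d%:R).
Local Notation gw := (gw_law c).
Local Notation E := (Ex p (edges e)).
Implicit Types (F : {set {set V}}) (t : ptree).

Let n0 : 0 < n. Proof. by rewrite ltr0n. Qed.
Let dR : 0 < d%:R :> R. Proof. by rewrite ltr0n. Qed.
Let p0 : 0 <= p. Proof. by rewrite divr_ge0// ltW. Qed.
Let p1 : p <= 1. Proof. by rewrite ler_pdivrMr// mul1r. Qed.

Lemma degree_le_card : (d <= #|V|)%N.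
Proof. by have /card_gt0P[v _] := V0; rewrite -(reg_e v) max_card. Qed.

Lemma card_edges : (#|edges e| <= #|V| * d)%N.
Proof.
pose q := flatten [seq [seq [set x; y]%SET | y <- enum [set w | e x w]%SET] | x <- enum V].
apply: (@leq_trans (size q)); last first.
  by rewrite cardE; apply: size_flatten_le => x; rewrite size_map -cardE reg_e.
apply: leq_trans (subset_leq_card _) (card_size _); apply/fintype.subsetP => E.
case/edgesP => x [y [exy ->]]; apply/flatten_mapP; exists x; rewrite ?mem_enum//.
by apply/mapP; exists y; rewrite ?mem_enum ?inE.
Qed.

(** [flow] is split as [fgood - fbad]: [fgood] depends on the explorations alone and has bounded
    differences, while [fbad] is small in expectation. *)
Definition fgood r t F : R := (cgood r t F)%:R / n.

Lemma fgoodE r t F : fgood r t F = \sum_(v : V) (good r t F v)%:R / n.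
Proof.
rewrite /fgood /cgood -mulr_suml; congr (_ / _); rewrite -natr_sum; congr _%:R.
by rewrite -sum1_card big_mkcond /=; apply: eq_bigr => v _; rewrite inE; case: good.
Qed.

Definition fbad r t F : R := \sum_(v : V) (good r t F v && bad r F v)%:R / n.

Lemma flowE r t F : flow r t F = fgood r t F - fbad r t F.
Proof.
rewrite fgoodE /fbad /flow -sumrB.
rewrite [LHS](_ : _ = \sum_(v : V) (good r t F v && ~~ bad r F v)%:R / n); last first.
  rewrite -mulr_suml; congr (_ / _); rewrite -natr_sum; congr _%:R.
  by rewrite -sum1_card big_mkcond /=; apply: eq_bigr => v _; rewrite inE; case: (_ && _).
apply: eq_bigr => v _; rewrite -mulrBl; congr (_ / _).
by case: good; case: bad; rewrite /= ?subrr ?subr0.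
Qed.

Lemma mean_over_vertices (f : V -> R) (x : R) : (forall v, f v <= x) -> \sum_(v : V) f v / n <= x.
Proof.
move=> fx; rewrite -mulr_suml ler_pdivrMr//; apply: le_trans (ler_sum _ (fun v _ => fx v)) _.
by rewrite sumr_const -[x *+ _]mulr_natr.
Qed.

Lemma mean_over_vertices_ge (f : V -> R) (x : R) : (forall v, x <= f v) -> x <= \sum_(v : V) f v / n.
Proof.
move=> fx; rewrite -mulr_suml ler_pdivlMr//; apply: le_trans _ (ler_sum _ (fun v _ => fx v)).
by rewrite sumr_const -[x *+ _]mulr_natr.
Qed.

Variables (K r : nat).
Hypotheses (K0 : (0 < K)%N) (Md : (K.+1 ^ r <= d)%N).
Local Notation M := (K.+1 ^ r)%N.

Lemma E_fgood t : bnd K r t ->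
  gw r t - M%:R * (((K * (M + K))%:R + c ^+ 2) / d%:R) <= E (fgood r t).
Proof.
move=> bt; rewrite (@eq_Ex _ _ _ _ _ (fun F => \sum_(v : V) (good r t F v)%:R / n)); last first.
  by move=> F _; exact: fgoodE.
rewrite Ex_sum (eq_bigr (fun v => E (fun F => (good r t F v)%:R) / n)); last first.
  by move=> v _; rewrite -ExZr.
apply: mean_over_vertices_ge => v; exact: good_prob_gw.
Qed.

(** [Ex_dev] with [L = 2M / n] and at most [n d] edges gives [2 M sqrt c / sqrt n]; finally [n >= d]
    in a [d]-regular graph. *)
Lemma dev_fgood t : bnd K r t ->
  E (fun F => `|fgood r t F - E (fgood r t)|) <= 2 * M%:R * Num.sqrt c / Num.sqrt d%:R.
Proof.
move=> bt; have L0 : 0 <= (2 * M)%:R / n :> R by rewrite divr_ge0// ltW.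
apply: le_trans (Ex_dev p0 p1 L0 _) _.
  move=> S F /edgesP[x [y [_ SE]]] _.
  have Sxy : exists x y, S = [set x; y]%SET by exists x, y.
  have [le1 le2] := cgood_toggle F K0 bt Sxy.
  rewrite /fgood -mulrBl normrM [`|n^-1|]ger0_norm; last by rewrite invr_ge0 ltW.
  apply: ler_wpM2r; first by rewrite invr_ge0 ltW.
  move: le1 le2; rewrite -!(ler_nat R) !natrD => le1 le2.
  by rewrite ler_norml; apply/andP; split; lra.
have ep : #|edges e|%:R * p <= n * c.
  rewrite mulrA ler_pdivrMr// [leRHS]mulrAC; apply: ler_wpM2r; first exact: ltW.
  by rewrite -natrM ler_nat card_edges.
apply: (@le_trans _ _ (Num.sqrt (n * c) * ((2 * M)%:R / n))).
  by apply: ler_wpM2r => //; rewrite ler_sqrt// mulr_ge0// ltW.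
rewrite (sqrtrM _ (ltW n0)) natrM.
have sn : 0 < Num.sqrt n by rewrite sqrtr_gt0.
have sd : 0 < Num.sqrt d%:R :> R by rewrite sqrtr_gt0.
have sdn : Num.sqrt d%:R <= Num.sqrt n by rewrite ler_sqrt ?ler_nat ?degree_le_card// ltW.
have -> : Num.sqrt n * Num.sqrt c * (2 * M%:R / n) = 2 * M%:R * Num.sqrt c / Num.sqrt n.
  have nE : Num.sqrt n * Num.sqrt n = n by rewrite -expr2 sqr_sqrtr// ltW.
  rewrite -{2}nE; field; by rewrite gt_eqF.
apply: ler_wpM2l; first by rewrite !mulr_ge0 ?sqrtr_ge0.
by rewrite lef_pV2 ?posrE.
Qed.

(** A union bound over the edges [S]: being extra is independent of [S] being open, which gives the
    factor [p], and a good vertex has at most [M^2] extra edges. *)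
Lemma E_fbad t : bnd K r t -> E (fbad r t) <= p * (M ^ 2)%:R.
Proof.
move=> bt; rewrite Ex_sum (eq_bigr (fun v => E (fun F => (good r t F v && bad r F v)%:R) / n)); last first.
  by move=> v _; rewrite -ExZr.
apply: mean_over_vertices => v.
pose g S F : R := (good r t F v && extra r F v S)%:R.
apply: (@le_trans _ _ (E (fun F => \sum_(S in edges e) g S F * ((S \in F) == true)%:R))).
  apply: le_Ex => // F FO; have [/andP[gv /existsP[S /andP[SF xS]]]|_] := boolP (_ && _); last first.
    by apply: sumr_ge0 => S _; rewrite mulr_ge0.
  have SO : S \in edges e by exact: (fintype.subsetP FO).
  rewrite (bigD1 S)//= /g gv xS SF eqxx mulr1 lerDl; apply: sumr_ge0 => S' _.
  by rewrite mulr_ge0.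
rewrite Ex_sum (eq_bigr (fun S => p * E (g S))); last first.
  move=> S SO; rewrite (Ex_toggle p true SO)// => F _.
  by rewrite /g extra_toggle.
rewrite -mulr_sumr -Ex_sum; apply: ler_wpM2l => //.
rewrite -[leRHS](Ex_cst p (edges e)); apply: le_Ex => // F FO.
have [gv|ngv] := boolP (good r t F v); last first.
  by rewrite big1// => S _; rewrite /g (negbTE ngv).
have -> : \sum_(S in edges e) g S F = #|[set S in edges e | extra r F v S]%SET|%:R.
  rewrite -sum1_card natr_sum (eq_bigl (fun S => (S \in edges e) && extra r F v S)); last first.
    by move=> S; rewrite inE.
  by rewrite big_mkcondr; apply: eq_bigr => S _; rewrite /g gv; case: extra.
rewrite ler_nat; apply: leq_trans (card_extra _ _ _ _) _; apply: expn_leqW.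
move: gv => /andP[/eqP shE _]; rewrite size_labels shE; exact: size_positions_bnd.
Qed.

(** Collects the bias [2 + c^2], the fluctuation [2 sqrt c] and the extra edges [c]. *)
Definition C0 : R := 2 + c ^+ 2 + 2 * Num.sqrt c + c.

Lemma C0_ge0 : 0 <= C0.
Proof. by rewrite !addr_ge0 ?mulr_ge0 ?sqrtr_ge0 ?sqr_ge0 ?ltW. Qed.

(** Trees outside [trees K r] account for at most half of [x]. The other half is a sum of errors
    over [trees K r], handled by Markov's inequality. *)
Lemma perc_dTV (x : R) (Q : {set {set V}} -> bool) : 0 < x -> 1 - gmass c K r <= x / 2 ->
  (forall F, Q F -> (x%:E <= dTV (mu_emp (sub_adj F) r) (mu_gw c r))%E) ->
  perc_prob e p Q <=
  2 / x * (C0 * (K.+1 ^ (K.+1 ^ r + 3 * r.+1))%:R / Num.sqrt d%:R).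
Proof.
move=> x0 tail HQ; rewrite perc_probE.
have x2 : 0 < x / 2 by rewrite divr_gt0.
(* [W] dominates both [M] and [K], so [W^3] covers the worst term [M K (M + K)] up to a constant. *)
set W : R := (K.+1 ^ r.+1)%:R.
pose h : R := M%:R * (((K * (M + K))%:R + c ^+ 2) / d%:R).
(* Bias, fluctuation and extra edges: together they bound how far [flow] falls below [gw]. *)
pose U t F := h + `|fgood r t F - E (fgood r t)| + fbad r t F.
have h0 : 0 <= h by rewrite mulr_ge0// divr_ge0// addr_ge0 ?sqr_ge0.
have fb0 t F : 0 <= fbad r t F by apply: sumr_ge0 => v _; rewrite divr_ge0// ltW.
have U0 t F : 0 <= U t F by rewrite !addr_ge0.
apply: le_trans (Ex_markov p0 p1 x2 (f := fun F => \sum_(t <- trees K r) U t F) _ _) _.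
- by move=> F _; apply: sumr_ge0.
- move=> F FO /HQ h1; have := le_trans h1 (dTV_le c0 V0 K r F); rewrite lee_fin => h2.
  have : \sum_(t <- trees K r) (gw r t - Num.min (gw r t) (flow r t F)) <= \sum_(t <- trees K r) U t F.
    rewrite big_seq [leRHS]big_seq; apply: ler_sum => t; rewrite mem_trees => bt.
    have Eg := E_fgood bt; have := fb0 t F; have ab := ler_norm (E (fgood r t) - fgood r t F).
    rewrite distrC in ab; rewrite /U -/h in Eg *.
    case: (leP (gw r t) (flow r t F)) => [_|]; first by rewrite subrr U0.
    by rewrite flowE; lra.
  by rewrite sumrB -/(gmass c K r); lra.
have sd : 0 < Num.sqrt d%:R :> R by rewrite sqrtr_gt0.
have W1 : 1 <= W by rewrite ler1n expn_gt0.
have MW : M%:R <= W by rewrite ler_nat leq_exp2l.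
have KW : K%:R <= W.
  by rewrite ler_nat; apply: leq_trans (leqnSn K) _; rewrite -{1}(expn1 K.+1) leq_exp2l.
have W3 : W * W <= W ^+ 3 by rewrite -expr2; apply: ler_weXn2l.
have W31 : W <= W ^+ 3 by rewrite -{1}(expr1 W); apply: ler_weXn2l.
have M0 : 0 <= M%:R :> R by [].
have KR0 : 0 <= K%:R :> R by [].
have MM : M%:R * M%:R <= W * W by apply: ler_pM.
have dinv : d%:R^-1 <= (Num.sqrt d%:R)^-1 :> R.
  rewrite lef_pV2 ?posrE// -{2}(sqr_sqrtr (ltW dR)) expr2; apply: ler_peMl; first exact: ltW.
  by rewrite -[leLHS]sqrtr1 ler_sqrt// ler1n.
have EU t : bnd K r t -> E (U t) <= C0 * W ^+ 3 / Num.sqrt d%:R.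
  move=> bt; rewrite ExD ExD Ex_cst; have := dev_fgood bt; have := E_fbad bt.
  have hb : h <= (2 + c ^+ 2) * W ^+ 3 / Num.sqrt d%:R.
    rewrite /h mulrA; apply: ler_pM => //.
      by rewrite mulr_ge0// addr_ge0// sqr_ge0.
    rewrite natrM natrD mulrDr [leRHS]mulrDl; apply: lerD.
      have : K%:R * (M%:R + K%:R) <= W * (W + W) by apply: ler_pM => //; exact: lerD.
      have Wp : 0 <= W by lra.
      move=> KK; apply: (@le_trans _ _ (W * (W * (W + W)))).
        by apply: ler_pM => //; rewrite mulr_ge0// addr_ge0.
      by rewrite le_eqVlt; apply/orP; left; apply/eqP; ring.
    by rewrite mulrC; apply: ler_wpM2l; rewrite ?sqr_ge0//; lra.
  have db : 2 * M%:R * Num.sqrt c / Num.sqrt d%:R <= 2 * Num.sqrt c * W ^+ 3 / Num.sqrt d%:R.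
    apply: ler_wpM2r; first by rewrite invr_ge0 ltW.
    rewrite mulrAC; apply: ler_wpM2l; first by rewrite mulr_ge0// sqrtr_ge0.
    lra.
  have bb : p * (M ^ 2)%:R <= c * W ^+ 3 / Num.sqrt d%:R.
    rewrite mulrAC; apply: ler_pM => //.
      by rewrite mulr_ge0// ltW.
    apply: ler_wpM2l; first exact: ltW.
    by rewrite natrX expr2; lra.
  by rewrite /C0 !mulrDl -/p; move: hb; rewrite !mulrDl; lra.
rewrite Ex_sum.
apply: (@le_trans _ _ ((size (trees K r))%:R * (C0 * W ^+ 3 / Num.sqrt d%:R) / (x / 2))).
  apply: ler_wpM2r; first by rewrite invr_ge0 ltW.
  rewrite (_ : _%:R * _ = \sum_(t <- trees K r) (C0 * W ^+ 3 / Num.sqrt d%:R)); last first.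
    by rewrite big_const_seq count_predT iter_addr_0 mulr_natl.
  rewrite big_seq [leRHS]big_seq.
  by apply: ler_sum => t; rewrite mem_trees; exact: EU.
have W3E : W ^+ 3 = (K.+1 ^ (3 * r.+1))%:R by rewrite -natrX -expnM mulnC.
rewrite expnD natrM -W3E.
have -> : 2 / x * (C0 * ((K.+1 ^ M)%:R * W ^+ 3) / Num.sqrt d%:R) =
  (K.+1 ^ M)%:R * (C0 * W ^+ 3 / Num.sqrt d%:R) / (x / 2).
  by field; rewrite !gt_eqF.
apply: ler_wpM2r; first by rewrite invr_ge0 ltW.
apply: ler_wpM2r; last by rewrite ler_nat size_trees.
by rewrite divr_ge0 ?(ltW sd)// mulr_ge0 ?C0_ge0// exprn_ge0//; lra.
Qed.

End NonAsymptotic.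

(** * Asymptotics *)

Lemma cvg0_eventually (R : realType) (f : nat -> R) :
  (forall eps, 0 < eps -> exists x0 : R, forall d, x0 <= d%:R -> 0 <= f d <= eps) ->
  f @ \oo --> 0.
Proof.
move=> H; apply/cvgrPdist_le => eps /H[x0 Hx0]; near=> d.
have /Hx0/andP[f0 fe] : x0 <= d%:R by near: d; exact: nbhs_infty_ger.
by rewrite sub0r normrN ger0_norm.
Unshelve. all: by end_near. Qed.

Lemma nat_above (R : realType) (x : R) : 0 <= x ->
  exists K, [/\ (0 < K)%N, x < K%:R & K%:R <= x + 1].
Proof.
move=> x0; exists (Num.truncn x).+1; have /andP[Kl Ku] := truncn_itv x0.
by split=> //; rewrite -natr1 lerD2r.
Qed.

Section Asymptotics.
Context {R : realType}.
Variables (c : R) (c0 : 0 < c).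

Definition C1 r : R := 4 * (3 ^+ r + (3 * r.+1)%:R).

Lemma C1_ge0 r : 0 <= C1 r.
Proof. by rewrite mulr_ge0// addr_ge0// exprn_ge0. Qed.

(** With [K] about [s^2], the base is at most [3 s^2 <= exp(4 s)] and the exponent is
    [O(s^(2r))]. *)
Lemma branching_pow_le (s : R) K r : 1 <= s -> K%:R <= s ^+ 2 + 1 ->
  (K.+1 ^ (K.+1 ^ r + 3 * r.+1))%:R <= expR (C1 r * s ^+ (2 * r).+1).
Proof.
move=> s1 Ks; have s0 : 0 <= s by lra.
have b3 : K.+1%:R <= 3 * s ^+ 2.
  have : 1 <= s ^+ 2 by rewrite exprn_ege1.
  by rewrite -[K.+1]addn1 natrD; lra.
have be : K.+1%:R <= expR (4 * s).
  apply: (le_trans b3).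
  have e3 : 3 <= expR (2 * s) by apply: le_trans (expR_ge1Dx _); lra.
  have es : s <= expR s by apply: le_trans (expR_ge1Dx _); lra.
  rewrite (_ : 4 * s = 2 * s + (s + s)); last by ring.
  by rewrite !expRD expr2; apply: ler_pM => //; [exact: mulr_ge0|apply: ler_pM].
rewrite natrX; apply: le_trans (lerXn2r _ _ _ be) _; rewrite ?nnegrE ?expR_ge0//.
rewrite -expRM_natl ler_expR natrD.
have sr1 : 1 <= s ^+ (2 * r) by rewrite exprn_ege1.
have Ms : (K.+1 ^ r)%:R <= 3 ^+ r * s ^+ (2 * r).
  by rewrite natrX exprM -exprMn; apply: lerXn2r; rewrite ?nnegrE ?mulr_ge0 ?sqr_ge0.
have : (K.+1 ^ r)%:R + (3 * r.+1)%:R <= (3 ^+ r + (3 * r.+1)%:R) * s ^+ (2 * r).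
  rewrite mulrDl; apply: lerD => //; exact: ler_peMr.
move=> /(ler_wpM2r (mulr_ge0 (ler0n R 4) s0)) /le_trans; apply.
by rewrite /C1 exprS le_eqVlt; apply/orP; left; apply/eqP; ring.
Qed.

Definition ctail r : R := (\sum_(i < r) c ^+ i) * expR (c * expR 1 - c).

Lemma ctail_ge0 r : 0 <= ctail r.
Proof.
by rewrite mulr_ge0 ?expR_ge0//; apply: sumr_ge0 => i _; rewrite exprn_ge0// ltW.
Qed.

Lemma gmass_ctail K r : 1 - gmass c K r <= ctail r * expR (- K%:R).
Proof. by rewrite /ctail -mulrA -expRD; exact: gmass_tail. Qed.

Section Graph.
Variables (V : finType) (e : rel V) (d r : nat).
Hypotheses (sym_e : symmetric e) (reg_e : forall v, #|[set w | e v w]%SET| = d).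
Hypotheses (V0 : (0 < #|V|)%N) (d0 : (0 < d)%N) (cd : c <= d%:R).

Let dR : 0 < d%:R :> R. Proof. by rewrite ltr0n. Qed.

Lemma perc_prob_ge0 Q : 0 <= perc_prob e (c / d%:R) Q.
Proof.
rewrite perc_probE; apply: Ex_ge0 => //; first by rewrite divr_ge0// ltW.
by rewrite ler_pdivrMr// mul1r.
Qed.

(** Chosen so that [log d = s^(4r)] and the degree cutoff [(log d)^(1/(2r))] is [s^2]. *)
Let s : R := ln d%:R `^ ((4 * r%:R)^-1).

(** The logarithm of the bound is [C1 y + s^2/4 - z/2 + z/3] with [z = log d] and [y = s^(2r+1)].
    The remaining [- z/6] absorbs all other terms, as [z >= s y] for [r > 0]. *)
Lemma perc_rate : (0 < r)%N -> 1 + 6 * (2 + C1 r) + 4 * ctail r <= s ->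
  perc_prob e (c / d%:R)
    (fun F => ((expR (- (4^-1 * (ln d%:R) `^ ((2 * r%:R)^-1))))%:E
                     <= dTV (mu_emp (sub_adj F) r) (mu_gw c r))%E)
        / (d%:R `^ (- 3^-1)) <= 2 * C0 c * expR (- s).
Proof.
move=> r0 sS; have C1r := C1_ge0 r; have ct := ctail_ge0 r.
have s1 : 1 <= s by lra.
have s0 : 0 <= s by lra.
have L0 : 0 <= ln d%:R :> R by rewrite ln_ge0// ler1n.
have rR : r%:R != 0 :> R by rewrite pnatr_eq0 -lt0n.
have sL : s ^+ (4 * r) = ln d%:R.
  by rewrite -powR_mulrn// /s -powRrM natrM mulVf ?powRr1// mulf_neq0.
have -> : ln d%:R `^ ((2 * r%:R)^-1) = s ^+ 2 :> R.
  by rewrite -powR_mulrn// /s -powRrM; congr (_ `^ _); field.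
set z := s ^+ (4 * r) in sL; set y := s ^+ (2 * r).+1.
have dE : d%:R = expR z by rewrite sL lnK// posrE.
have sqrtE : Num.sqrt d%:R = expR (z / 2).
  have -> : d%:R = expR (z / 2) ^+ 2 by rewrite expr2 -expRD -splitr.
  by rewrite sqrtr_sqr ger0_norm// expR_ge0.
have powE : d%:R `^ (- 3^-1) = expR (- (z / 3)).
  by rewrite /powR gt_eqF// -sL mulNr mulrC.
(* The 6 is the inverse of [1/2 - 1/3]. One of the two spare copies of [y] pays for [s^2/4], the
   other leaves [- s]. *)
have yz : 6 * (2 + C1 r) * y <= z.
  apply: (@le_trans _ _ (s * y)).
    by apply: ler_wpM2r; [rewrite exprn_ge0|lra].
  by rewrite /y /z -exprS; apply: ler_weXn2l => //; lia.
have sy : s <= y by rewrite -{1}(expr1 s); apply: ler_weXn2l.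
have s2y : s ^+ 2 <= y by apply: ler_weXn2l => //; lia.
have C1y : 0 <= C1 r * y by rewrite mulr_ge0// exprn_ge0.
have [K [K0 Ku Ks]] := nat_above (sqr_ge0 s).
have bK := branching_pow_le r s1 Ks.
have Md : (K.+1 ^ r <= d)%N.
  rewrite -(ler_nat R) dE; apply: (@le_trans _ _ (K.+1 ^ (K.+1 ^ r + 3 * r.+1))%:R).
    rewrite ler_nat leq_exp2l//; apply: leq_trans (leq_addr _ _); exact: ltnW (ltn_expl _ _).
  apply: (le_trans bK); rewrite ler_expR -/y {bK}; lra.
(* The mass [O(exp(-s^2))] lies below the threshold [exp(-s^2/4)]; the gap [3/4 s^2] absorbs the
   constant [2 ctail]. *)
have tail : 1 - gmass c K r <= expR (- (4^-1 * s ^+ 2)) / 2.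
  apply: le_trans (gmass_ctail _ _) _.
  apply: (@le_trans _ _ (ctail r * expR (- s ^+ 2))).
    by apply: ler_wpM2l => //; rewrite ler_expR lerN2 ltW.
  have e1 : 2 * ctail r <= expR (3 / 4 * s ^+ 2).
    apply: le_trans (expR_ge1Dx _); have : s <= s ^+ 2 by rewrite -{1}(expr1 s); apply: ler_weXn2l.
    by move=> ss; have := C1_ge0 r; lra.
  rewrite (_ : - (4^-1 * s ^+ 2) = 3 / 4 * s ^+ 2 + - s ^+ 2); last by field.
  rewrite expRD [leRHS]mulrAC; apply: ler_wpM2r; first exact: expR_ge0.
  by rewrite ler_pdivlMr// mulrC.
have := @perc_dTV R c V e d c0 sym_e reg_e V0 d0 cd K r K0 Md _
  (fun F => ((expR (- (4^-1 * s ^+ 2)))%:E <= dTV (mu_emp (sub_adj F) r) (mu_gw c r))%E)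
  (expR_gt0 _) tail (fun F h => h).
rewrite sqrtE powE => P.
rewrite -expRN opprK; apply: le_trans (ler_wpM2r (expR_ge0 _) P) _.
set b := (K.+1 ^ _)%:R in bK *.
have -> : 2 / expR (- (4^-1 * s ^+ 2)) * (C0 c * b / expR (z / 2)) * expR (z / 3) =
   2 * C0 c * (b * expR (4^-1 * s ^+ 2 - z / 2 + z / 3)).
  rewrite !expRD !expRN; field; by rewrite !gt_eqF ?expR_gt0.
apply: ler_wpM2l; first by rewrite mulr_ge0// C0_ge0.
apply: le_trans (ler_wpM2r (expR_ge0 _) bK) _.
by rewrite -expRD ler_expR -/y; lra.
Qed.

End Graph.
End Asymptotics.

Theorem theorem3p1 (R : realType) (c : R) (V : nat -> finType)
    (e : forall d : nat, rel (V d))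
    (hc : 0 < c)
    (hsym : forall d, symmetric (e d))
    (hirr : forall d, irreflexive (e d))
    (hreg : forall d, regular (e d) d)
    (hne : forall d, (0 < #|V d|)%N) :
  (forall r : nat, (0 < r)%N ->
     (fun d : nat =>
        perc_prob (e d) (c / d%:R)
          (fun F => ((expR (- (4^-1 * (ln d%:R) `^ ((2 * r%:R)^-1))))%:E
                     <= dTV (mu_emp (sub_adj F) r) (mu_gw c r))%E)
        / (d%:R `^ (- 3^-1))) @ \oo --> 0)
  /\
  (forall (r : nat) (A : set rcode), rclass A ->
   forall eps : R, 0 < eps ->
     (fun d : nat =>
        perc_prob (e d) (c / d%:R)
          (fun F => (eps%:E < `| (mu_emp (sub_adj F) r A)%:E - mu_gw c r A |)%E))
     @ \oo --> 0).
Proof.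
split=> [r r0|r A cA eps eps0]; apply: cvg0_eventually => delta delta0.
  set S0 : R := 1 + 6 * (2 + C1 r) + 4 * ctail c r.
  have S01 : 1 <= S0 by have := @C1_ge0 R r; have := ctail_ge0 hc r; rewrite /S0; lra.
  (* [S0] is what [perc_rate] requires; the second term makes [2 C0 exp(-s) <= delta], since
     [exp s >= s >= S]. *)
  set S : R := S0 + 2 * C0 c / delta.
  have CC : 0 <= 2 * C0 c by rewrite mulr_ge0// C0_ge0.
  have S00 : S0 <= S by rewrite lerDl divr_ge0// ltW.
  exists (c + expR (S ^+ (4 * r))) => d dS.
  have dR : 0 < d%:R :> R by apply: lt_le_trans dS; rewrite addr_gt0// expR_gt0.
  have d0 : (0 < d)%N by rewrite -(ltr0n R).
  have cd : c <= d%:R by apply: le_trans dS; rewrite lerDl expR_ge0.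
  have Sd : S ^+ (4 * r) <= ln d%:R.
    rewrite -ler_expR lnK ?posrE//; apply: le_trans dS; rewrite lerDr; exact: ltW.
  rewrite divr_ge0 ?powR_ge0 ?perc_prob_ge0//=.
  have L0 : 0 <= ln d%:R :> R by apply: le_trans Sd; rewrite exprn_ge0//; lra.
  set s : R := ln d%:R `^ ((4 * r%:R)^-1).
  have Ss : S <= s.
    have r4 : (0 < 4 * r)%N by rewrite muln_gt0.
    rewrite -(@ler_pXn2r _ _ r4) ?nnegrE ?powR_ge0//; last lra.
    rewrite -(@powR_mulrn _ s) ?powR_ge0// /s -powRrM natrM mulVf ?powRr1//.
    by rewrite mulf_neq0// pnatr_eq0 -lt0n.
  apply: le_trans (perc_rate hc (hsym d) (hreg d) (hne d) d0 cd r0 _) _; first exact: le_trans Ss.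
  have sE : s <= expR s by apply: le_trans (expR_ge1Dx _); lra.
  rewrite -/s expRN ler_pdivrMr ?expR_gt0// [leRHS]mulrC -ler_pdivrMr//.
  by apply: le_trans sE; apply: le_trans Ss; rewrite lerDr; lra.
(* A single class differs by at most twice the distance, so the distance is tested at [eps / 2]. Now
   [K] is fixed and the probability is [O(d^(-1/2))]; this also covers [r = 0]. *)
have eps2 : 0 < eps / 2 by rewrite divr_gt0.
have ct := ctail_ge0 hc r.
have [K [K0 Ku _]] : exists K, [/\ (0 < K)%N, 4 * ctail c r / eps < K%:R & K%:R <= 4 * ctail c r / eps + 1].
  by apply: nat_above; apply: divr_ge0; [exact: mulr_ge0|exact: ltW].
have tail : 1 - gmass c K r <= eps / 2 / 2.
  apply: le_trans (gmass_ctail hc _ _) _.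
  have Ke : 4 * ctail c r < K%:R * eps by rewrite -ltr_pdivrMr.
  have KE : K%:R <= expR K%:R :> R by apply: le_trans (expR_ge1Dx _); lra.
  rewrite expRN ler_pdivrMr ?expR_gt0//.
  have := ler_wpM2r (ltW eps0) KE; lra.
set B : R := 2 / (eps / 2) * (C0 c * (K.+1 ^ (K.+1 ^ r + 3 * r.+1))%:R).
have B0 : 0 <= B.
  by rewrite mulr_ge0//; [rewrite divr_ge0// ltW|rewrite mulr_ge0// C0_ge0].
(* The last summand ensures [B / sqrt d <= delta]. *)
exists (1 + c + (K.+1 ^ r)%:R + (B / delta) ^+ 2) => d dS.
have M0 : 0 <= (K.+1 ^ r)%:R :> R by [].
have B2 : 0 <= (B / delta) ^+ 2 := sqr_ge0 _.
have dR : 0 < d%:R :> R by lra.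
have d0 : (0 < d)%N by rewrite -(ltr0n R).
have cd : c <= d%:R by lra.
have Md : (K.+1 ^ r <= d)%N by rewrite -(ler_nat R); lra.
rewrite perc_prob_ge0//=.
apply: le_trans (perc_dTV hc (hsym d) (hreg d) (hne d) d0 cd K0 Md eps2 tail _) _.
  move=> F lt; rewrite leNgt; apply/negP => lt2.
  have := lt_le_trans lt (le_dTV c F r cA); rewrite ltNge => /negP; apply.
  have := lee_wpmul2l (ler0n R 2 : (0 <= 2%:E)%E) (ltW lt2).
  by move=> /le_trans; apply; rewrite -EFinM lee_fin; lra.
rewrite mulrA -/B ler_pdivrMr ?sqrtr_gt0// [leRHS]mulrC -ler_pdivrMr//.
have Bd : 0 <= B / delta by rewrite divr_ge0// ltW.
rewrite -(@ler_pXn2r _ 2) ?nnegrE ?sqrtr_ge0// sqr_sqrtr; [lra|exact: ltW].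
Qed.
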